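(* Let $k\ge1$ and $n>k$ be integers, $a=n-k$, $b=k(n-k)-1$, and let $x>0$, $y\ge0$ be real numbers. With $\mathbf a=(\underbrace{x,\ldots,x}_{k},\underbrace{y,\ldots,y}_{n-k},-kx-(n-k)y)$, $$\operatorname{vol}\mathcal F_{\mathrm{Car}^{(k)}_{n+1}}(\mathbf a)=\mathrm{Cat}(a,b)\cdot k^{b-1}x^{b}\,(kx+(n-k)y)^{a-1}.$$
   Context: $\mathrm{Car}^{(k)}_{n+1}$ is the directed graph (no multiple edges) on $\{1,\ldots,n+1\}$ with edges $(i,i+1),(i,k+1),\ldots,(i,n)$ for $1\le i\le k$ and $(i,i+1),(i,n+1)$ for $k+1\le i\le n$. For $\mathbf a=(a_1,\ldots,a_n,-\sum a_i)$ with $a_i\ge0$ real, $\mathcal F_G(\mathbf a)$ is the set of nonnegative edge flows $(f_e)_{e\in E}$ with outflow minus inflow at vertex $j$ equal to $a_j$ for $j\le n$. The normalized volume of a $d$-dimensional polytope is $d!$ times its relative volume with respect to the integer lattice of its affine span direction. $\mathrm{Cat}(a,b)=\frac1{a+b}\binom{a+b}{a}$. *)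

(* Defs.v *)
From HB Require Import structures.
From mathcomp Require Import all_boot all_order all_algebra.
From mathcomp Require Import all_classical all_reals all_analysis.

Set Implicit Arguments.
Unset Strict Implicit.
Unset Printing Implicit Defensive.

Import Order.TTheory GRing.Theory Num.Theory.

Local Open Scope classical_set_scope.
Local Open Scope ring_scope.

(* The product measure of d copies of the Lebesgue measure, by iterating the
   section formula that defines [product_measure1]; as a measure it is only
   meant to be used on Borel sets. *)
Fixpoint lebesgue_tuple (R : realType) (d : nat) :
    set (d.-tuple R) -> \bar R :=
  match d with
  | 0 => fun A => (\d_ ([tuple] : 0.-tuple R) A)%E
  | d'.+1 => fun A =>
      (\int[@lebesgue_measure R]_t
         @lebesgue_tuple R d' [set s | A (cons_tuple (t : R) s)])%E
  end.

Section RelativeVolume.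
Variables (R : realType) (I : finType).
Implicit Types (P : set (I -> R)) (v : I -> R).

(* Linear span of P - P, i.e. the direction of the affine span of P. *)
Definition direction P : set (I -> R) :=
  [set v | exists (m : nat) (c : 'I_m -> R) (p q : 'I_m -> I -> R),
     [/\ forall i, P (p i), forall i, P (q i) &
         forall e, v e = \sum_(i < m) c i * (p i e - q i e)]].

Definition direction_lattice P : set (I -> R) :=
  [set v | direction P v /\ forall e, v e \is a Num.int].

(* B is a Z-basis of the lattice and an R-basis of the direction; in
   particular d is the dimension of P. *)
Definition is_lattice_basis P (d : nat) (B : 'I_d -> I -> R) : Prop :=
  [/\ forall i, direction_lattice P (B i),
      forall c : 'I_d -> R,
        (forall e, \sum_(i < d) c i * B i e = 0) -> forall i, c i = 0,
      forall v, direction_lattice P v ->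
        exists c : 'I_d -> int, forall e, v e = \sum_(i < d) (c i)%:~R * B i e
    & forall v, direction P v ->
        exists c : 'I_d -> R, forall e, v e = \sum_(i < d) c i * B i e].

(* Lebesgue measure of P in the affine coordinates with origin p and basis B. *)
Definition volume_in P (d : nat) (B : 'I_d -> I -> R) (p : I -> R) : \bar R :=
  lebesgue_tuple
    [set t : d.-tuple R | P (fun e => p e + \sum_(i < d) tnth t i * B i e)].

(* The value does not depend on the chosen lattice basis and origin; it is 0
   by convention when P is empty or when its direction has no lattice basis. *)
Definition normalized_volume P : \bar R :=
  xget 0%E
    [set w | exists (d : nat) (B : 'I_d -> I -> R) (p : I -> R),
       [/\ is_lattice_basis P B, P p & w = ((d`!)%:R%:E * volume_in P B p)%E]].

End RelativeVolume.

(* The element j of 'I_n.+1 stands for the vertex j.+1 of {1, ..., n+1}. *)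
Definition edge (n : nat) (G : {set 'I_n.+1 * 'I_n.+1}) : finType :=
  {e : 'I_n.+1 * 'I_n.+1 | e \in G}.

Definition flow_polytope (R : realType) (n : nat)
    (G : {set 'I_n.+1 * 'I_n.+1}) (a : 'I_n.+1 -> R) : set (edge G -> R) :=
  [set f | (forall e, 0 <= f e) /\
     forall j : 'I_n.+1, (j < n)%N ->
       \sum_(e : edge G | (val e).1 == j) f e
       - \sum_(e : edge G | (val e).2 == j) f e = a j].

Arguments flow_polytope {R n} G a _.

(* i and j are vertex labels in {1, ..., n+1}. *)
Definition car_edge (k n i j : nat) : bool :=
  [|| (1 <= i <= k)%N && ((j == i.+1) || (k.+1 <= j <= n)%N)
    | (k.+1 <= i <= n)%N && ((j == i.+1) || (j == n.+1))].

Definition car_graph (k n : nat) : {set 'I_n.+1 * 'I_n.+1} :=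
  [set e : 'I_n.+1 * 'I_n.+1 | car_edge k n e.1.+1 e.2.+1]%SET.

Definition car_netflow (R : realType) (k n : nat) (x y : R) : 'I_n.+1 -> R :=
  fun j => if (j < k)%N then x
           else if (j < n)%N then y
           else - (k%:R * x) - (n - k)%:R * y.

Arguments car_netflow {R} k n x y _.

Definition rational_catalan (R : realType) (a b : nat) : R :=
  (a + b)%:R^-1 * 'C(a + b, a)%:R.

(* Main.v *)
Require Import Defs.
From HB Require Import structures.
From mathcomp Require Import all_boot all_order all_algebra.
From mathcomp Require Import all_classical all_reals all_analysis.
From mathcomp Require Import measurable_realfun ring lra zify.

(* Write n = k + m.  A flow is determined by the k x m matrix M of its values
   on the edges (i, k+j) and by the vector u of its values on the edges
   (k+j, n+1); the values on the two paths are partial sums, and their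
   nonnegativity says that the partial sums of x minus the row sums of M, and
   of (column sums of M) + y - u, are nonnegative.  Without these conditions,
   (M, u) ranges over the product of two simplices with sums kx and kx + my.
   Rotating the rows of M, respectively the columns of M together with u,
   permutes the positions at which the two sequences of partial sums reach
   their minimum (cycle lemma), so the product of simplices is, up to null
   sets, a disjoint union of km copies of the flow polytope under lattice
   automorphisms.  Hence the volume is
   (kx)^(km-1) / (km-1)! * (kx+my)^(m-1) / (m-1)! / (km). *)

Set Implicit Arguments.
Unset Strict Implicit.
Unset Printing Implicit Defensive.

Import Order.TTheory GRing.Theory Num.Theory.
Import numFieldNormedType.Exports.

Local Open Scope classical_set_scope.
Local Open Scope ring_scope.

(** * Lebesgue measure on tuples *)

Section ConsPair.
Variable R : realType.

(** [normalized_volume] is a choice among all lattice bases and origins, so the formula has to be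
    proved for every one of them. This calls for a linear change of variables for the iterated
    measure; the resulting invariance under unimodular maps serves a second time for the rotations.
    Rows and columns rotate independently, because a row rotation preserves the column sums and a
    column rotation the row sums; this gives the full number km of copies. Copies overlap only where
    a minimum is reached twice, on zero sets of nonconstant affine functions. The direction of the
    polytope must be shown to be the whole space of flows with zero net flow; a strictly positive
    flow gives this, and x > 0 suffices for its existence even if y = 0. Finally the dimension is a
    + b - 1 and Cat(a, b) = (a+b-1)! / (a! b!): division by km turns (m-1)! into a! and lowers the
    power of k from b to b - 1. From the cycle lemma on, [k.+1] and [m.+1] stand for the k and m
    above. *)

Definition cons_pair d (u : measurableTypeR R * d.-tuple R) : d.+1.-tuple R :=
  cons_tuple (u.1 : R) u.2.

Lemma measurable_cons_pair d : measurable_fun setT (@cons_pair d).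
Proof.
apply: (@measurable_cons _ _ _ (R : measurableType _)
  (fst : measurableTypeR R * d.-tuple R -> R) d snd).
- exact: measurable_fst.
- exact: measurable_snd.
Qed.

Definition uncons_pair d (t : d.+1.-tuple R) : measurableTypeR R * d.-tuple R :=
  (thead t, [tuple of behead t]).

Lemma cons_pairK d : cancel (@cons_pair d) (@uncons_pair d).
Proof.
move=> [t s]; rewrite /uncons_pair /cons_pair /= theadE; congr pair.
exact: val_inj.
Qed.

Lemma measurable_uncons_pair d : measurable_fun setT (@uncons_pair d).
Proof.
apply/measurable_fun_pairP; split.
- exact: (@measurable_tnth _ (R : measurableType _) d.+1 ord0).
- exact: (@measurable_behead _ (R : measurableType _) d).
Qed.

Variables (d : nat) (mu : {sigma_finite_measure set (d.-tuple R) -> \bar R}).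

(** As the pushforward of a product measure this is a measure by construction, while its sections
    give exactly the recursion of [lebesgue_tuple]. *)
Definition cons_measure (A : set (d.+1.-tuple R)) : \bar R :=
  pushforward (@lebesgue_measure R \x mu)%E (@cons_pair d) A.

Let cons_measure0 : cons_measure set0 = 0%E.
Proof. by rewrite /cons_measure/pushforward preimage_set0 measure0. Qed.

Let cons_measure_ge0 A : (0 <= cons_measure A)%E.
Proof. by rewrite /cons_measure /pushforward measure_ge0. Qed.

Let cons_measure_sigma_additive : semi_sigma_additive cons_measure.
Proof.
exact: (@measure_semi_sigma_additive _ _ _
 (measure_function_pushforward__canonical__measure_function_Measure
   (@lebesgue_measure R \x mu)%E (@measurable_cons_pair d))).
Qed.

HB.instance Definition _ := isMeasure.Build _ _ _ cons_measure
  cons_measure0 cons_measure_ge0 cons_measure_sigma_additive.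

Let cons_measure_sigma_finite : sigma_finite setT cons_measure.
Proof.
have /sigma_finiteP[F [TF ndF Foo]] := sigma_finiteT (@lebesgue_measure R).
have /sigma_finiteP[G [TG ndG Goo]] := sigma_finiteT mu.
(* Both exhaustions are increasing, so a point lying in [F i] and [G j] lies in the box of index
   [maxn i j]. *)
exists (fun n => @uncons_pair d @^-1` (F n `*` G n)).
  rewrite -preimage_bigcup (_ : \bigcup_n _ = setT) ?preimage_setT//.
  rewrite -subTset => -[x y] _.
  have [i _ Fix] : (\bigcup_n F n) x by rewrite -TF.
  have [j _ Gjy] : (\bigcup_n G n) y by rewrite -TG.
  exists (maxn i j) => //; split => /=.
  - by move: Fix; exact/subsetPset/ndF/leq_maxl.
  - by move: Gjy; exact/subsetPset/ndG/leq_maxr.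
move=> n; have [mF Fn] := Foo n; have [mG Gn] := Goo n; split.
  rewrite -[X in measurable X]setTI; apply: measurable_uncons_pair => //.
  exact: measurableX.
rewrite /cons_measure /pushforward -comp_preimage.
rewrite (_ : _ \o _ = id); last by apply/funext => u /=; exact: cons_pairK.
by rewrite preimage_id product_measure1E// lte_mul_pinfty// ge0_fin_numE.
Qed.

HB.instance Definition _ := Measure_isSigmaFinite.Build _ _ _ cons_measure
  cons_measure_sigma_finite.

Lemma cons_measureE A :
  cons_measure A = (\int[@lebesgue_measure R]_t mu [set s | A (cons_tuple (t : R) s)])%E.
Proof.
rewrite /cons_measure /pushforward; apply: eq_integral => t _ /=.
by congr (mu _); apply/seteqP; split => s /=; rewrite /xsection /= ?inE.
Qed.

End ConsPair.

Section TupleMeasure.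
Variable R : realType.

(** [lebesgue_tuple] is a bare set function. Its measure structure is found by induction together
    with sigma-finiteness, which the next product requires. *)
Let lebesgue_tupleP d :
  exists mu : {sigma_finite_measure set (d.-tuple R) -> \bar R},
    @lebesgue_tuple R d = mu.
Proof.
elim: d => [|d [mu muE]].
  by exists (@dirac _ (0.-tuple R) [tuple] R).
exists (@cons_measure R d mu); apply/funext => A /=.
by rewrite [RHS]cons_measureE muE.
Qed.

Variable d : nat.

Let lebesgue_tuple0 : @lebesgue_tuple R d set0 = 0%E.
Proof. by have [mu ->] := lebesgue_tupleP d; rewrite measure0. Qed.

Let lebesgue_tuple_ge0 A : (0 <= @lebesgue_tuple R d A)%E.
Proof. by have [mu ->] := lebesgue_tupleP d. Qed.

Let lebesgue_tuple_sigma_additive : semi_sigma_additive (@lebesgue_tuple R d).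
Proof.
by have [mu ->] := lebesgue_tupleP d; exact: measure_semi_sigma_additive.
Qed.

HB.instance Definition _ := isMeasure.Build _ _ _ (@lebesgue_tuple R d)
  lebesgue_tuple0 lebesgue_tuple_ge0 lebesgue_tuple_sigma_additive.

Let lebesgue_tuple_sigma_finite : sigma_finite setT (@lebesgue_tuple R d).
Proof. by have [mu ->] := lebesgue_tupleP d; exact: sigma_finiteT. Qed.

HB.instance Definition _ := Measure_isSigmaFinite.Build _ _ _
  (@lebesgue_tuple R d) lebesgue_tuple_sigma_finite.

End TupleMeasure.

(** * Both orders of integration *)

Section Fubini.
Variable R : realType.

Lemma lebesgue_tupleS d (A : set (d.+1.-tuple R)) :
  lebesgue_tuple A =
  (\int[@lebesgue_measure R]_t lebesgue_tuple [set s | A (cons_tuple (t : R) s)])%E.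
Proof. by []. Qed.

Lemma measurable_cons_pair_preimage d (A : set (d.+1.-tuple R)) :
  measurable A -> measurable (@cons_pair R d @^-1` A).
Proof.
by move=> mA; rewrite -[X in measurable X]setTI; exact: measurable_cons_pair.
Qed.

Lemma measurable_lebesgue_tuple_section d (A : set (d.+1.-tuple R)) :
  measurable A ->
  measurable_fun [set: measurableTypeR R]
    (fun t => lebesgue_tuple [set s | A (cons_tuple (t : R) s)]).
Proof.
move=> mA.
have := @measurable_fun_xsection _ _ _ _ R (@lebesgue_tuple R d) _
  (@measurable_cons_pair_preimage _ _ mA).
congr measurable_fun; apply/funext => t /=.
by congr lebesgue_tuple; apply/seteqP; split => s /=; rewrite /xsection /= ?inE.
Qed.

(** The definition integrates over the head last. Maps that alter the head by an amount depending on
    the tail need the head integrated first. *)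
Lemma lebesgue_tupleS_swap d (A : set (d.+1.-tuple R)) : measurable A ->
  lebesgue_tuple A =
  (\int[@lebesgue_tuple R d]_s
     @lebesgue_measure R [set t | A (cons_tuple (t : R) s)])%E.
Proof.
move=> mA.
have mA' := @measurable_cons_pair_preimage _ _ mA.
transitivity ((@lebesgue_measure R \x (@lebesgue_tuple R d))%E (@cons_pair R d @^-1` A)).
  rewrite lebesgue_tupleS; apply: eq_integral => t _ /=.
  by congr lebesgue_tuple; apply/seteqP; split => s /=; rewrite /xsection /= ?inE.
transitivity ((@lebesgue_measure R \x^ (@lebesgue_tuple R d))%E (@cons_pair R d @^-1` A)).
  apply: product_measure_unique => // B C mB mC /=.
  exact: product_measure2E.
apply: eq_integral => s _ /=.
by congr lebesgue_measure; apply/seteqP; split => t /=; rewrite /ysection /= ?inE.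
Qed.

End Fubini.

(** * Linear change of variables *)

Section Affine1.
Variable R : realType.

Lemma measurable_affine1 (a b : R) :
  measurable_fun [set: measurableTypeR R]
    ((fun t : R => a * t + b) : measurableTypeR R -> measurableTypeR R).
Proof.
apply: (@measurable_funD _ (measurableTypeR R) R); last exact: measurable_cst.
exact: mulrl_measurable.
Qed.

Lemma lebesgue_measure_affine (a b : R) (A : set R) : a != 0 -> measurable A ->
  (`|a|%:E * @lebesgue_measure R [set t | A (a * t + b)%R])%E = lebesgue_measure A.
Proof.
move=> a0 mA.
have na0 : 0 < `|a| by rewrite normr_gt0.
pose f := (fun t : R => a * t + b) : measurableTypeR R -> measurableTypeR R.
pose nu := measure_function_pushforward__canonical__measure_function_Measure
  (@lebesgue_measure R) (measurable_affine1 a b).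
pose c : {nonneg R} := NngNum (normr_ge0 a).
(* Both sides are measures in [A], so it suffices to compare them on half-open intervals. *)
rewrite [RHS](@lebesgue_measure_unique R (mscale c nu))//.
move=> X [[x y] _ <-] /=.
rewrite /mscale/= /pushforward /=.
rewrite [LHS]lebesgue_measure_itv/=.
have [a_gt0|a_le0] := ltP 0 a.
  rewrite [X in lebesgue_measure X](_ : _ = [set` `](x - b) / a, (y - b) / a]]); last first.
    apply/seteqP; split => t /=; rewrite !in_itv /= ltr_pdivrMr// ler_pdivlMr//;
      by rewrite ltrBlDr lerBrDr [a * t]mulrC.
  rewrite lebesgue_measure_itv/= !lte_fin ltr_pM2r ?invr_gt0// ltrD2r.
  rewrite (gtr0_norm a_gt0); case: ifPn => _; last by rewrite mule0.
  by rewrite -!EFinD -EFinM; congr EFin; field.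
(* A negative slope reverses the interval and moves the closed end to the left, which does not
   change the length. *)
have a_lt0 : a < 0 by rewrite lt_neqAle a0.
rewrite [X in lebesgue_measure X](_ : _ = [set` `[(y - b) / a, (x - b) / a[]); last first.
  apply/seteqP; split => t /=; rewrite !in_itv /= ltr_ndivlMr// ler_ndivrMr//;
    by rewrite ltrBlDr lerBrDr [a * t]mulrC andbC.
rewrite lebesgue_measure_itv/= !lte_fin ltr_nM2r ?invr_lt0// ltrD2r.
rewrite (ltr0_norm a_lt0); case: ifPn => _; last by rewrite mule0.
by rewrite -!EFinD -EFinM; congr EFin; field.
Qed.
End Affine1.

Section ChangeOfVariables.
Variable R : realType.

Lemma measurable_lebesgue_section_swap d (A : set (d.+1.-tuple R)) :
  measurable A ->
  measurable_fun [set: d.-tuple R]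
    (fun s => @lebesgue_measure R [set t | A (cons_tuple (t : R) s)]).
Proof.
move=> mA.
have := @measurable_fun_ysection _ _ _ _ R (@lebesgue_measure R) _
  (@measurable_cons_pair_preimage R _ _ mA).
congr measurable_fun; apply/funext => s /=.
by congr lebesgue_measure; apply/seteqP; split => t /=; rewrite /ysection /= ?inE.
Qed.

Lemma measurable_section_swap d (A : set (d.+1.-tuple R)) (s : d.-tuple R) :
  measurable A -> measurable ([set t | A (cons_tuple (t : R) s)] : set (measurableTypeR R)).
Proof.
move=> /(@measurable_cons_pair_preimage R _ _) /(measurable_ysection s).
by congr measurable; apply/seteqP; split => t /=; rewrite /ysection /= ?inE.
Qed.

Lemma measurable_section d (A : set (d.+1.-tuple R)) (t : R) :
  measurable A -> measurable [set s | A (cons_tuple t s)].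
Proof.
move=> /(@measurable_cons_pair_preimage R _ _) /(measurable_xsection (t : measurableTypeR R)).
by congr measurable; apply/seteqP; split => s /=; rewrite /xsection /= ?inE.
Qed.

(** For a fixed tail the head undergoes a one-dimensional affine map whose offset is constant, so
    the claim holds inside the integral over the tail. *)
Lemma lebesgue_tuple_head d (A B : set (d.+1.-tuple R)) (a : R)
    (g : d.-tuple R -> R) : a != 0 -> measurable A -> measurable B ->
    (forall t s, B (cons_tuple t s) = A (cons_tuple (a * t + g s) s)) ->
  (`|a|%:E * lebesgue_tuple B = lebesgue_tuple A)%E.
Proof.
move=> a0 mA mB BA; rewrite !lebesgue_tupleS_swap// -ge0_integralZl//.
- apply: eq_integral => s _.
  rewrite -[RHS](@lebesgue_measure_affine R a (g s))//.
    by congr (_ * lebesgue_measure _)%E; apply/funext => t /=.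
  exact: measurable_section_swap.
- exact: measurable_lebesgue_section_swap.
Qed.

Lemma lebesgue_tuple_behead d (A B : set (d.+1.-tuple R)) (c : R) :
    0 <= c -> measurable B ->
    (forall t, (c%:E * lebesgue_tuple [set s | B (cons_tuple t s)] =
                lebesgue_tuple [set s | A (cons_tuple t s)])%E) ->
  (c%:E * lebesgue_tuple B = lebesgue_tuple A)%E.
Proof.
move=> c0 mB BA; rewrite !lebesgue_tupleS -ge0_integralZl//.
- by apply: eq_integral => t _.
- exact: measurable_lebesgue_tuple_section.
Qed.

Definition row_of_tuple d (t : d.-tuple R) : 'rV[R]_d := \row_i tnth t i.
Definition tuple_of_row d (v : 'rV[R]_d) : d.-tuple R := [tuple v 0 i | i < d].

Lemma row_of_tupleK d : cancel (@row_of_tuple d) (@tuple_of_row d).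
Proof. by move=> t; apply/eq_from_tnth => i; rewrite tnth_mktuple mxE. Qed.

Lemma tuple_of_rowK d : cancel (@tuple_of_row d) (@row_of_tuple d).
Proof. by move=> v; apply/rowP => i; rewrite mxE tnth_mktuple. Qed.

Lemma row_of_cons d (t : R) (s : d.-tuple R) :
  row_of_tuple (cons_tuple t s) = row_mx t%:M (row_of_tuple s) :> 'rV_(1 + d).
Proof.
apply/rowP => i; rewrite !mxE; case: splitP => j /= ij.
  rewrite !mxE !ord1 /= mulr1n (_ : i = ord0) ?tnth0//.
  by apply: val_inj; rewrite /= ij ord1.
rewrite mxE (_ : i = lift ord0 j) ?tnthS//.
exact: val_inj.
Qed.

Lemma tuple_of_row_mx d (t : R) (v : 'rV[R]_d) :
  @tuple_of_row d.+1 (row_mx t%:M v : 'rV_(1 + d)) = cons_tuple t (tuple_of_row v).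
Proof.
by apply: (can_inj (@row_of_tupleK d.+1)); rewrite tuple_of_rowK row_of_cons tuple_of_rowK.
Qed.

Lemma measurable_affine_form d (c : R) (w : 'I_d -> R) :
  measurable_fun [set: d.-tuple R] (fun t => c + \sum_i tnth t i * w i).
Proof.
apply: measurable_funD; first exact: measurable_cst.
apply: measurable_sum => i.
by apply: measurable_funM; [exact: measurable_tnth|exact: measurable_cst].
Qed.

Lemma measurable_affine_preimage d (N : 'M[R]_d) (q : 'rV[R]_d) (A : set (d.-tuple R)) :
  measurable A -> measurable [set t | A (tuple_of_row (row_of_tuple t *m N + q))].
Proof.
move=> mA.
have mf : measurable_fun [set: d.-tuple R]
    (fun t : d.-tuple R => tuple_of_row (row_of_tuple t *m N + q)).
  apply/measurable_fun_tnthP => j.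
  have := @measurable_affine_form d (q 0 j) (fun i => N i j).
  congr measurable_fun; apply/funext => t /=.
  rewrite tnth_mktuple !mxE addrC; congr (_ + _).
  by apply: eq_bigr => i _; rewrite mxE.
by rewrite -[X in measurable X]setTI; exact: mf.
Qed.

Lemma lebesgue_tuple_translate d (q : 'rV[R]_d) (A : set (d.-tuple R)) :
  measurable A ->
  lebesgue_tuple [set t | A (tuple_of_row (row_of_tuple t + q))] = lebesgue_tuple A.
Proof.
elim: d q A => [|d IH] q A mA.
  congr lebesgue_tuple; apply/funext => t /=; congr A.
  by rewrite [RHS]tuple0 [LHS]tuple0.
have qE : q = row_mx (q 0 0)%:M (rsubmx (q : 'rV_(1 + d))) :> 'rV_(1 + d).
  rewrite -(hsubmxK (q : 'rV_(1 + d))) row_mxKr; congr row_mx; apply/rowP => i.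
  rewrite !mxE !ord1 mulr1n.
  case: splitP => j /= ij; rewrite ?ord1 ?mxE; last by [].
  by congr (q _ _); apply: val_inj.
have mB (p : 'rV_d.+1) : measurable [set t | A (tuple_of_row (row_of_tuple t + p))].
  have := @measurable_affine_preimage _ 1%:M p _ mA.
  by under eq_fun do rewrite mulmx1.
have aff t s r p : tuple_of_row (@row_of_tuple d.+1 (cons_tuple t s) +
   (row_mx r%:M p : 'rV_(1 + d))) = cons_tuple (t + r) (tuple_of_row (row_of_tuple s + p)).
  rewrite -tuple_of_row_mx [in LHS]row_of_cons; congr tuple_of_row.
  by rewrite [LHS](@add_row_mx _ 1 1 d) -raddfD.
(* The translation is split: [A'] moves the tail only, by induction; the head is then moved by a
   constant. *)
pose A' := [set t | A (tuple_of_row (row_of_tuple t + (row_mx 0%:M (rsubmx (q : 'rV_(1 + d))) : 'rV_(1 + d))))].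
transitivity (lebesgue_tuple A').
  rewrite -[LHS]mul1e -{1}(normr1 R).
  apply: (@lebesgue_tuple_head _ _ _ 1 (fun=> q 0 0)) => //.
  - exact: mB.
  - move=> t s /=; rewrite {1}qE aff /A' /=.
    by congr A; rewrite aff addr0; congr cons_tuple; rewrite mul1r.
rewrite -[LHS]mul1e.
apply: lebesgue_tuple_behead; [exact: ler01|exact: mB|move=> t; rewrite mul1e].
rewrite -[RHS](IH (rsubmx (q : 'rV_(1 + d))) _ (@measurable_section _ _ t mA)).
by congr lebesgue_tuple; apply/funext => s /=; rewrite /A' /= aff addr0.
Qed.

(** This property is stable under products, so it is enough to factor invertible matrices into block
    triangular ones. *)
Let scales d (N : 'M[R]_d) := forall A : set (d.-tuple R), measurable A ->
  (`|\det N|%:E * lebesgue_tuple [set t | A (tuple_of_row (row_of_tuple t *m N))] =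
   lebesgue_tuple A)%E.

Let measurable_linear_preimage d (N : 'M[R]_d) (A : set (d.-tuple R)) :
  measurable A -> measurable [set t | A (tuple_of_row (row_of_tuple t *m N))].
Proof.
move=> mA; have := @measurable_affine_preimage _ N 0 _ mA.
by under eq_fun do rewrite addr0.
Qed.

Let scales_mul d (N1 N2 : 'M[R]_d) : scales N1 -> scales N2 -> scales (N1 *m N2).
Proof.
move=> H1 H2 A mA; rewrite -[RHS](H2 A mA).
rewrite -(H1 _ (@measurable_linear_preimage _ N2 _ mA)) muleA -EFinM -normrM.
rewrite det_mulmx [\det N2 * _]mulrC; congr (_ * lebesgue_tuple _)%E.
by apply/funext => t /=; rewrite tuple_of_rowK mulmxA.
Qed.

Let scales_head d (a : R) (e : 'cV[R]_d) : a != 0 ->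
  @scales (1 + d) (block_mx a%:M 0 e 1%:M).
Proof.
move=> a0 A mA; rewrite det_lblock det_scalar1 det1 mulr1.
apply: (@lebesgue_tuple_head _ _ _ a (fun s => (row_of_tuple s *m e) 0 0)) => //.
  exact: measurable_linear_preimage.
move=> t s /=; congr A.
rewrite -[in RHS](row_of_tupleK s) -tuple_of_row_mx tuple_of_rowK [in LHS]row_of_cons; congr tuple_of_row.
rewrite mul_row_block mulmx0 add0r mulmx1 -scalar_mxM raddfD /= [t * a]mulrC.
by congr (row_mx (_ + _) _); apply: mx11_scalar.
Qed.

(** With the head [t] fixed by the outer integral, the tail undergoes [S] followed by the
    translation by [t *: c]. *)
Let scales_behead d (c : 'rV[R]_d) (S : 'M[R]_d) : scales S ->
  @scales (1 + d) (block_mx 1%:M c 0 S).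
Proof.
move=> HS A mA; rewrite det_ublock det1 mul1r.
apply: lebesgue_tuple_behead => //; first exact: measurable_linear_preimage.
move=> t; rewrite -[RHS](@lebesgue_tuple_translate _ (t *: c)); last exact: measurable_section.
rewrite -[RHS](HS); last first.
  have := @measurable_affine_preimage _ 1%:M (t *: c) _ (@measurable_section _ _ t mA).
  by under eq_fun do rewrite mulmx1.
congr (_ * lebesgue_tuple _)%E; apply/funext => s /=; congr A.
rewrite -tuple_of_row_mx [in LHS]row_of_cons; congr tuple_of_row.
rewrite mul_row_block mulmx0 addr0 mulmx1 tuple_of_rowK addrC mul_scalar_mx.
by rewrite addrC.
Qed.

(** Gaussian elimination by blocks: with a nonzero pivot [a], the matrix is a lower factor times an
    upper factor containing the Schur complement [S]. Since the determinant is [a] times that of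
    [S], the induction applies to [S]. *)
Let scales_unitmx d (N : 'M[R]_d) : N \in unitmx -> scales N.
Proof.
elim: d N => [|d IH] N uN.
  move=> A mA; rewrite det_mx00 normr1 mul1e.
  congr lebesgue_tuple; apply/funext => t /=; congr A.
  by rewrite [RHS]tuple0 [LHS]tuple0.
have pivot (N' : 'M[R]_(1 + d)) : N' \in unitmx -> N' 0 0 != 0 -> scales N'.
  move=> uN' p0; set a := N' 0 0 in p0.
  pose c := a^-1 *: ursubmx N'; pose e := dlsubmx N'.
  pose S := drsubmx N' - e *m c.
  have NE : N' = block_mx a%:M 0 e 1%:M *m block_mx 1%:M c 0 S.
    rewrite mulmx_block !mulmx1 !mul0mx !mulmx0 !addr0 mul1mx.
    rewrite [X in block_mx _ X](_ : _ = ursubmx N'); last first.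
      by rewrite mul_scalar_mx scalerA mulfV// scale1r.
    rewrite [X in block_mx _ _ _ X](_ : _ = drsubmx N'); last first.
      by rewrite addrC subrK.
    rewrite (_ : a%:M = ulsubmx N') ?submxK//.
    rewrite [RHS]mx11_scalar; congr (_%:M); rewrite !mxE.
    by congr (N' _ _); apply: val_inj.
  rewrite NE; apply: scales_mul; first exact: scales_head.
  apply: scales_behead; apply: IH.
  move: uN'; rewrite !unitmxE NE det_mulmx det_lblock det_ublock !det1 mulr1 mul1r.
  by rewrite !unitfE mulf_eq0 negb_or => /andP[].
have [p0|] := eqVneq (N 0 0) 0; last exact: pivot.
(* A zero pivot is removed by adding another column to the first one. *)
have [j Nj] : exists j : 'I_d, ursubmx (N : 'M[R]_(1 + d)) 0 j != 0.
  apply/existsP; apply: contraT; rewrite negb_exists => /forallP N0.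
  move: uN; rewrite unitmxE unitfE (expand_det_row N 0) big1 ?eqxx// => i _.
  case: (unliftP ord0 i) => [l ->|->]; last by rewrite p0 mul0r.
  move: (N0 l); rewrite negbK !mxE => /eqP.
  rewrite (_ : lshift d 0 = 0); last exact: val_inj.
  by rewrite (_ : rshift 1 l = lift ord0 l) => [->|]; [rewrite mul0r|exact: val_inj].
pose E b : 'M[R]_(1 + d) := block_mx 1%:M 0 (b *: delta_mx j 0) 1%:M.
have uE b : E b \in unitmx by rewrite unitmxE det_lblock !det1 mulr1 unitr1.
have EE : E 1 *m E (-1) = 1%:M.
  rewrite mulmx_block !mulmx1 !mul1mx !mulmx0 !mul0mx !addr0 !add0r.
  by rewrite scaleN1r scale1r subrr -scalar_mx_block.
have -> : N = (N : 'M[R]_(1 + d)) *m E 1 *m E (-1) by rewrite -mulmxA EE mulmx1.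
apply: scales_mul; last exact: scales_head.
apply: pivot; first by rewrite unitmx_mul uN uE.
rewrite -(submxK (N : 'M[R]_(1 + d))) mulmx_block mulmx1.
have -> : 0 = lshift d 0 :> 'I_(1 + d) by exact: val_inj.
rewrite block_mxEul !mxE.
rewrite (bigD1 j)//= big1 ?addr0; last first.
  by move=> i ij; rewrite !mxE (negbTE ij) /= mulr0 mulr0.
rewrite !mxE !eqxx /= mulr1 mulr1.
rewrite (_ : lshift d 0 = 0); last exact: val_inj.
by rewrite p0 add0r; move: Nj; rewrite !mxE (_ : lshift d 0 = 0)//; exact: val_inj.
Qed.

Lemma lebesgue_tuple_linear d (N : 'M[R]_d) (A : set (d.-tuple R)) :
  N \in unitmx -> measurable A ->
  (`|\det N|%:E * lebesgue_tuple [set t | A (tuple_of_row (row_of_tuple t *m N))] =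
   lebesgue_tuple A)%E.
Proof. by move=> uN; exact: scales_unitmx. Qed.

Lemma lebesgue_tuple_affine d (N : 'M[R]_d) (q : 'rV[R]_d) (A : set (d.-tuple R)) :
  `|\det N| = 1 -> measurable A ->
  lebesgue_tuple [set t | A (tuple_of_row (row_of_tuple t *m N + q))] = lebesgue_tuple A.
Proof.
move=> dN mA.
have uN : N \in unitmx by rewrite unitmxE unitfE -normr_gt0 dN.
rewrite -[RHS](@lebesgue_tuple_translate _ q)// -[RHS](@lebesgue_tuple_linear _ N)//.
  rewrite dN mul1e; congr lebesgue_tuple; apply/funext => t /=.
  by rewrite tuple_of_rowK.
have := @measurable_affine_preimage _ 1%:M q _ mA.
by under eq_fun do rewrite mulmx1.
Qed.

End ChangeOfVariables.

(** * Lattice bases and null sets *)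

Section LatticeBasis.
Variables (R : realType) (I : finType).
Implicit Types (W P : set (I -> R)).

(** The notion [is_lattice_basis] with an arbitrary set [W] in place of the direction of a polytope,
    so that bases can be compared and transported without reference to a polytope. *)
Definition is_zbasis W (d : nat) (B : 'I_d -> I -> R) : Prop :=
  [/\ forall i, W (B i) /\ forall e, B i e \is a Num.int,
      forall c : 'I_d -> R,
        (forall e, \sum_(i < d) c i * B i e = 0) -> forall i, c i = 0,
      forall v, W v /\ (forall e, v e \is a Num.int) ->
        exists c : 'I_d -> int, forall e, v e = \sum_(i < d) (c i)%:~R * B i e
    & forall v, W v ->
        exists c : 'I_d -> R, forall e, v e = \sum_(i < d) c i * B i e].

Lemma zbasis_transition W d d' (B : 'I_d -> I -> R) (B' : 'I_d' -> I -> R) :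
  is_zbasis W B -> is_zbasis W B' ->
  exists N : 'M[int]_(d', d), forall i e, B' i e = \sum_j (N i j)%:~R * B j e.
Proof.
move=> [_ _ spanB _] [latB' _ _ _].
have /fin_all_exists[c cE] i : exists c : 'I_d -> int,
    forall e, B' i e = \sum_j (c j)%:~R * B j e by exact: spanB.
exists (\matrix_(i, j) c i j) => i e; rewrite cE.
by apply: eq_bigr => j _; rewrite mxE.
Qed.

Lemma zbasis_transitionK W d d' (B : 'I_d -> I -> R) (B' : 'I_d' -> I -> R)
    (N : 'M[int]_(d', d)) (N' : 'M[int]_(d, d')) :
  is_zbasis W B ->
  (forall i e, B' i e = \sum_j (N i j)%:~R * B j e) ->
  (forall i e, B i e = \sum_j (N' i j)%:~R * B' j e) ->
  N' *m N = 1%:M.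
Proof.
move=> [_ freeB _ _] NE N'E; apply/matrixP => i j; apply: (@intr_inj R).
apply/eqP; rewrite -subr_eq0; apply/eqP.
move: j; apply: freeB => e.
under eq_bigr do rewrite mulrBl.
rewrite sumrB; apply/eqP; rewrite subr_eq0; apply/eqP.
transitivity (B i e); last first.
  rewrite (bigD1 i)//= big1 => [|j ij]; first by rewrite mxE eqxx mulr1n mul1r addr0.
  by rewrite mxE eq_sym (negbTE ij) mulr0n mul0r.
rewrite N'E; under [RHS]eq_bigr do rewrite NE mulr_sumr.
rewrite exchange_big /=; apply: eq_bigr => j _.
rewrite mxE rmorph_sum /= mulr_suml; apply: eq_bigr => l _.
by rewrite rmorphM /= mulrA.
Qed.

(** The two determinants are nonzero integers with product 1, so each has absolute value at least 1
    and hence exactly 1. *)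
Lemma int_unimodular d (N N' : 'M[int]_d) : N *m N' = 1%:M ->
  `|\det (map_mx (intr : int -> R) N)| = 1.
Proof.
move=> NN; have /(congr1 determinant) := NN.
rewrite det_mulmx det1 det_map_mx => dd.
rewrite -intr_norm; suff -> : `|\det N| = 1 by [].
have d0 : \det N != 0 by apply: contra_eq_neq dd => ->; rewrite mul0r eq_sym oner_eq0.
have d0' : \det N' != 0 by apply: contra_eq_neq dd => ->; rewrite mulr0 eq_sym oner_eq0.
apply/eqP; rewrite eq_le; apply/andP; split; last by rewrite -gtz0_ge1 normr_gt0.
have := congr1 Num.norm dd; rewrite normrM normr1 => <-.
by rewrite ler_peMr// -gtz0_ge1 normr_gt0.
Qed.

(** Passing to another basis is a unimodular substitution and passing to another origin a
    translation. The dimensions agree because the transition matrices are inverse to each other. *)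
Lemma zbasis_volume W P d d' (B : 'I_d -> I -> R) (B' : 'I_d' -> I -> R)
    (p p' : I -> R) :
  is_zbasis W B -> is_zbasis W B' -> W (fun e => p' e - p e) ->
  measurable [set t : d.-tuple R | P (fun e => p e + \sum_(i < d) tnth t i * B i e)] ->
  d' = d /\ volume_in P B' p' = volume_in P B p.
Proof.
move=> zB zB' Wp mP.
have [N NE] := zbasis_transition zB zB'.
have [N' N'E] := zbasis_transition zB' zB.
have N'N := zbasis_transitionK zB NE N'E.
have NN' := zbasis_transitionK zB' N'E NE.
have dd : d' = d.
  apply/eqP; rewrite eqn_leq.
  have map1 n m (M1 : 'M[int]_(n, m)) M2 : M1 *m M2 = 1%:M -> (n <= m)%N.
    move=> /(congr1 (map_mx (intr : int -> R))); rewrite map_mxM map_mx1.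
    exact: mulmx1_min.
  by rewrite (map1 _ _ _ _ NN') (map1 _ _ _ _ N'N).
split => //; subst d'.
have [r rE] : exists c : 'I_d -> R, forall e, p' e - p e = \sum_(i < d) c i * B i e.
  by case: zB => _ _ _; apply.
rewrite /volume_in.
rewrite -[RHS](@lebesgue_tuple_affine R d (map_mx intr N) (\row_j r j))//; last first.
  exact: int_unimodular NN'.
congr lebesgue_tuple; apply/funext => t /=; congr P; apply/funext => e.
rewrite -[p' e](subrK (p e)) rE [X in X + _]addrC -addrA; congr (_ + _).
under [RHS]eq_bigr do rewrite tnth_mktuple !mxE mulrDl.
rewrite big_split /= addrC; congr (_ + _).
under [LHS]eq_bigr do rewrite NE mulr_sumr.
rewrite exchange_big /=; apply: eq_bigr => j _.
rewrite mulr_suml; apply: eq_bigr => i _.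
by rewrite !mxE mulrA.
Qed.

End LatticeBasis.

(** * Hyperplanes are null, and unions with null overlaps *)

Section NullSets.
Variable R : realType.

Lemma measurable_affine_eq0 d (c : R) (w : 'I_d -> R) :
  measurable [set t : d.-tuple R | c + \sum_i tnth t i * w i = 0].
Proof.
rewrite -[X in measurable X]setTI.
exact: (measurable_affine_form c w measurableT (measurable_set1 0)).
Qed.

Lemma measurable_affine_ge0 d (c : R) (w : 'I_d -> R) :
  measurable [set t : d.-tuple R | 0 <= c + \sum_i tnth t i * w i].
Proof.
have := measurable_affine_form c w measurableT (measurable_itv `[0, +oo[).
by rewrite setTI; congr measurable; apply/funext => t /=; rewrite in_itv/= andbT.
Qed.

(** If the head coefficient vanishes, every section is a hyperplane of lower dimension. Otherwise,
    for each tail exactly one head solves the equation, and the head is integrated first. *)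
Lemma lebesgue_tuple_hyperplane d (c : R) (w : 'I_d -> R) (i0 : 'I_d) :
  w i0 != 0 -> lebesgue_tuple [set t : d.-tuple R | c + \sum_i tnth t i * w i = 0] = 0%E.
Proof.
elim: d c w i0 => [|d IH] c w i0 wi0; first by case: i0 wi0.
have sumE t (s : d.-tuple R) : \sum_i tnth (cons_tuple t s) i * w i =
    t * w ord0 + \sum_i tnth s i * w (lift ord0 i).
  by rewrite big_ord_recl tnth0; congr (_ + _); apply: eq_bigr => i _; rewrite tnthS.
have [w0|w0] := eqVneq (w ord0) 0.
  rewrite lebesgue_tupleS integral0_eq// => t _ /=.
  under eq_fun do rewrite sumE addrA.
  case: (unliftP ord0 i0) => [j i0E|i0E]; last by move: wi0; rewrite i0E w0 eqxx.
  by apply: (IH _ (fun i => w (lift ord0 i)) j); rewrite -i0E.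
rewrite lebesgue_tupleS_swap; last exact: measurable_affine_eq0.
rewrite integral0_eq// => s _ /=.
rewrite [X in lebesgue_measure X](_ : _ =
   [set - (c + \sum_i tnth s i * w (lift ord0 i)) / w ord0]).
  exact: lebesgue_measure_set1.
apply/seteqP; split => t /=; rewrite sumE.
  move=> E; apply: (mulIf w0); rewrite mulfVK//; apply/eqP.
  by rewrite -addr_eq0; apply/eqP; rewrite -[RHS]E; ring.
by move=> ->; rewrite mulfVK//; ring.
Qed.

Lemma measure_ae_disjoint_union (dT : measure_display) (T : measurableType dT)
    (mu : {measure set T -> \bar R}) (K : finType) (F : K -> set T) :
  (forall c, measurable (F c)) ->
  (forall c c', c != c' -> mu (F c `&` F c') = 0%E) ->
  mu [set x | exists c, F c x] = (\sum_c mu (F c))%E.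
Proof.
move=> mF F0.
have mU (r : seq K) : measurable (\big[setU/set0]_(c <- r) F c).
  by apply: bigsetU_measurable.
suff H (r : seq K) : uniq r ->
    mu (\big[setU/set0]_(c <- r) F c) = (\sum_(c <- r) mu (F c))%E.
  rewrite -H ?index_enum_uniq//; congr (mu _).
  apply/seteqP; split => x.
    by move=> [c Fc]; rewrite -bigcup_seq; exists c => //=; rewrite mem_index_enum.
  by rewrite -bigcup_seq => -[c _ Fc]; exists c.
elim: r => [_|c r IH /= /andP[cr ur]]; first by rewrite !big_nil measure0.
rewrite !big_cons -(IH ur).
have I0 : mu (F c `&` \big[setU/set0]_(i <- r) F i) = 0%E.
  rewrite big_distrr /=; elim: r cr {ur IH} => [|c' r IH].
    by rewrite big_nil measure0.
  rewrite inE negb_or => /andP[cc' cr]; rewrite big_cons measureU0//.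
  - exact: F0.
  - exact: measurableI.
  - by apply: bigsetU_measurable => ? _; exact: measurableI.
  - exact: IH.
(* Cutting both [F c] and the union along the remaining sets avoids subtracting measures, which may
   be infinite. *)
have E := measureDI mu (mF c) (mU r).
rewrite [X in (_ = _ + X)%E]I0 adde0 in E.
rewrite (measureDI mu (measurableU _ _ (mF c) (mU r)) (mU r)).
rewrite setDUl setDv setU0 E; congr (_ + mu _)%E.
by apply/seteqP; split => x; [case|split => //; right].
Qed.

End NullSets.

(** * Products of two simplices *)

Section SimplexVolume.
Variable R : realType.

Lemma integral_simplex_section (q : nat) (c v : R) : 0 <= c ->
  (\int[@lebesgue_measure R]_(t in `[0%R, c]) ((c - t) ^+ q / q`!%:R * v)%:E =
   (c ^+ q.+1 / q.+1`!%:R * v)%:E)%E.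
Proof.
rewrite le_eqVlt => /predU1P[<-|c0].
  by rewrite set_itv1 integral_set1 expr0n /= mul0r mul0r.
(* An antiderivative of the integrand, taken as a polynomial so that its derivative is computed
   algebraically. *)
pose P : {poly R} := - (v / q.+1`!%:R) *: (c%:P - 'X) ^+ q.+1.
have PE t : P.[t] = - (v / q.+1`!%:R) * (c - t) ^+ q.+1.
  by rewrite /P !hornerE.
have dP t : P^`().[t] = (c - t) ^+ q / q`!%:R * v.
  rewrite /P derivZ deriv_exp derivB derivC derivX sub0r mulN1r hornerZ hornerMn hornerN.
  rewrite horner_exp hornerD hornerN hornerC hornerX factS natrM -[- _ *+ _]mulr_natr.
  have q0 : q`!%:R != 0 :> R by rewrite pnatr_eq0 -lt0n fact_gt0.
  have q1 : q.+1%:R != 0 :> R by rewrite pnatr_eq0.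
  by move: q.+1%:R q`!%:R q1 q0 => a b a0 b0; field; rewrite b0 a0.
rewrite (@continuous_FTC2 _ _ (fun t => P.[t]))//.
- by rewrite -EFinB !PE subrr subr0 expr0n /= mulr0 sub0r mulNr opprK; congr EFin; ring.
- apply: continuous_subspaceT => t.
  rewrite (_ : (fun _ => _) = (fun t => P^`().[t])); last by apply/funext.
  exact: continuous_horner.
- split.
  + by move=> t _; exact: derivable_horner.
  + by apply: cvg_at_right_filter; exact: continuous_horner.
  + by apply: cvg_at_left_filter; exact: continuous_horner.
- by move=> t _; rewrite -derivE dP.
Qed.

(** The recursion follows the iterated integral: each coordinate reduces the remaining budget [c].
    The condition [T] on what is left of the list allows a second simplex to be nested after the
    first. *)
Fixpoint in_simplex (q : nat) (c : R) (T : set (seq R)) (s : seq R) : Prop :=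
  match q, s with
  | 0, _ => 0 <= c /\ T s
  | q'.+1, t :: s' => 0 <= t /\ in_simplex q' (c - t) T s'
  | _.+1, [::] => False
  end.

Lemma in_simplex_ge0 q c T s : in_simplex q c T s -> 0 <= c.
Proof.
elim: q c s => [|q IH] c [|t s] //=; try by case.
by move=> [t0 /IH]; lra.
Qed.

Lemma in_simplexE q c T s : (q <= size s)%N ->
  in_simplex q c T s <->
  [/\ forall i, (i < q)%N -> 0 <= s`_i, \sum_(i < q) s`_i <= c & T (drop q s)].
Proof.
elim: q c s => [|q IH] c s /=.
  by rewrite big_ord0 drop0; split => [[]|[]].
case: s => // t s; rewrite ltnS => qs; rewrite IH// big_ord_recl /=; split.
  move=> [t0 [s0 sc Ts]]; split => //; last by rewrite -lerBrDl.
  by case=> // i /s0.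
move=> [s0 sc Ts]; split; first exact: (s0 0).
by split => //; [move=> i iq; exact: (s0 i.+1)|rewrite lerBrDl].
Qed.

Lemma lebesgue_in_simplex q d c (v : R) (T : set (seq R)) : 0 <= c ->
  lebesgue_tuple [set s : d.-tuple R | T s] = v%:E ->
  lebesgue_tuple [set s : (q + d).-tuple R | in_simplex q c T s] =
  (c ^+ q / q`!%:R * v)%:E.
Proof.
move=> c0 Tv; elim: q c c0 => [|q IH] c c0.
  rewrite expr0 fact0 divr1 mul1r -Tv; congr lebesgue_tuple.
  by apply/funext => s /=; apply/propext; split => [[]|].
rewrite -integral_simplex_section// [RHS]integral_mkcond lebesgue_tupleS.
apply: eq_integral => t _; rewrite patchE.
case: ifPn => [|/negP].
  rewrite inE /= in_itv /= => /andP[t0 tc].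
  rewrite -IH ?subr_ge0//; congr lebesgue_tuple.
  by apply/funext => s /=; apply/propext; split => [[]|].
rewrite inE /= in_itv /= => tc.
rewrite [X in lebesgue_tuple X](_ : _ = set0) ?measure0//.
apply/seteqP; split => s //= -[t0 /in_simplex_ge0]; rewrite subr_ge0 => tc'.
by apply: tc; rewrite t0 tc'.
Qed.

Lemma lebesgue_two_simplices q1 q2 (c1 c2 : R) : 0 <= c1 -> 0 <= c2 ->
  lebesgue_tuple [set s : (q1 + q2).-tuple R | [/\ forall i, 0 <= tnth s i,
      \sum_(i < q1) tnth s (lshift q2 i) <= c1 &
      \sum_(i < q2) tnth s (rshift q1 i) <= c2]] =
  (c1 ^+ q1 / q1`!%:R * (c2 ^+ q2 / q2`!%:R))%:E.
Proof.
move=> c10 c20.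
pose T := in_simplex q2 c2 setT.
have Tv : lebesgue_tuple [set s : q2.-tuple R | T s] = (c2 ^+ q2 / q2`!%:R)%:E.
  have := @lebesgue_in_simplex q2 0 c2 1 setT c20.
  rewrite mulr1 addn0; apply.
  by rewrite /= diracE /= mem_set.
rewrite -(lebesgue_in_simplex q1 c10 Tv); congr lebesgue_tuple.
apply/funext => s /=; apply/propext.
rewrite in_simplexE ?size_tuple ?leq_addr// /T.
have sz : size (drop q1 s) = q2 by rewrite size_drop size_tuple addKn.
rewrite (propext (in_simplexE c2 setT _)) ?sz//.
have E1 (i : 'I_q1) : tnth s (lshift q2 i) = s`_i by rewrite (tnth_nth 0).
have E2 (i : 'I_q2) : tnth s (rshift q1 i) = (drop q1 s)`_i.
  by rewrite (tnth_nth 0) nth_drop.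
under eq_bigr do rewrite E1; under [X in X <= c2]eq_bigr do rewrite E2.
split.
  move=> [s0 s1 s2]; split => //.
    by move=> i iq; rewrite -(E1 (Ordinal iq)).
  by split => // i iq; rewrite -(E2 (Ordinal iq)).
move=> [s0 s1 [s0' s2 _]]; split => // i.
by rewrite -(fintype.splitK i); case: (fintype.split i) => j /=; rewrite ?E1 ?E2; [exact: s0|exact: s0'].
Qed.

End SimplexVolume.

(** * Lattice bases for one and for two sum conditions *)

Section SumZeroBasis.
Variables (R : realType) (J : finType) (j0 : J).

Definition sum0_basis (a : 'I_#|predC1 j0|) (j : J) : R :=
  (j == enum_val a)%:R - (j == j0)%:R.

Lemma sum_predC1 (f : J -> R) :
  \sum_j f j = f j0 + \sum_(a < #|predC1 j0|) f (enum_val a).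
Proof. by rewrite (bigD1 j0)//= big_enum_val. Qed.

Lemma enum_val_predC1 (a : 'I_#|predC1 j0|) : enum_val a == j0 = false.
Proof. by have := enum_valP a; rewrite inE => /negbTE. Qed.

Lemma predC1P (j : J) : j = j0 \/ exists a : 'I_#|predC1 j0|, j = enum_val a.
Proof.
have [->|jj0] := eqVneq j j0; first by left.
have jP : j \in predC1 j0 by rewrite inE.
by right; exists (enum_rank_in jP j); rewrite enum_rankK_in.
Qed.

(** The coordinates are the values away from [j0]. Freeness, and integrality of the coordinates of
    an integer vector, follow at once. *)
Lemma sum0_basis_comb (c : 'I_#|predC1 j0| -> R) (b : 'I_#|predC1 j0|) :
  \sum_a c a * sum0_basis a (enum_val b) = c b.
Proof.
rewrite (bigD1 b)//= big1 ?addr0 => [|a ab]; rewrite /sum0_basis enum_val_predC1.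
  by rewrite eqxx subr0 mulr1.
by rewrite (inj_eq enum_val_inj) eq_sym (negbTE ab) subr0 mulr0.
Qed.

Lemma sum0_basis_comb0 (c : 'I_#|predC1 j0| -> R) :
  \sum_a c a * sum0_basis a j0 = - \sum_a c a.
Proof.
rewrite -sumrN; apply: eq_bigr => a _.
by rewrite /sum0_basis eqxx eq_sym enum_val_predC1 sub0r mulrN1.
Qed.

Lemma sum0_basis_span (v : J -> R) j : \sum_j v j = 0 ->
  v j = \sum_a v (enum_val a) * sum0_basis a j.
Proof.
rewrite sum_predC1 => v0; case: (predC1P j) => [->|[b ->]].
  by rewrite sum0_basis_comb0; apply/eqP; rewrite -addr_eq0 v0.
by rewrite (sum0_basis_comb (fun a => v (enum_val a))).
Qed.

Lemma sum0_basis_sum a : \sum_j sum0_basis a j = 0.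
Proof.
rewrite sumrB (bigD1 (enum_val a))//= big1 => [|j /negbTE ->//].
by rewrite (bigD1 j0)//= big1 => [|j /negbTE ->//]; rewrite !eqxx !addr0 subrr.
Qed.

Lemma sum0_basis_int a j : sum0_basis a j \is a Num.int.
Proof. by rewrite rpredB// rpred_nat. Qed.

End SumZeroBasis.

Section TwoSimplices.
Variables (R : realType) (J1 J2 : finType) (j1 : J1) (j2 : J2).
Let I : finType := (J1 + J2)%type.
Let q1 := #|predC1 j1|.
Let q2 := #|predC1 j2|.

Definition two_sum (c1 c2 : R) : set (I -> R) :=
  [set v | \sum_j v (inl j) = c1 /\ \sum_j v (inr j) = c2].

Definition two_simplices (c1 c2 : R) : set (I -> R) :=
  [set v | (forall e, 0 <= v e) /\ two_sum c1 c2 v].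

Definition two_basis (i : 'I_(q1 + q2)) (e : I) : R :=
  match fintype.split i, e with
  | inl a, inl j => sum0_basis R a j
  | inr a, inr j => sum0_basis R a j
  | _, _ => 0
  end.

(** A vertex of the product of simplices. Seen from it, the coordinates in [two_basis] are the
    entries other than [j1] and [j2], and nonnegativity of those two entries becomes the pair of
    bounds on the coordinate sums. *)
Definition two_corner (c1 c2 : R) (e : I) : R :=
  match e with
  | inl j => if j == j1 then c1 else 0
  | inr j => if j == j2 then c2 else 0
  end.

Let two_basis_ll a j : two_basis (lshift q2 a) (inl j) = sum0_basis R a j.
Proof. by rewrite /two_basis (unsplitK (inl _ a)). Qed.
Let two_basis_lr a j : two_basis (lshift q2 a) (inr j) = 0.
Proof. by rewrite /two_basis (unsplitK (inl _ a)). Qed.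
Let two_basis_rl a j : two_basis (rshift q1 a) (inl j) = 0.
Proof. by rewrite /two_basis (unsplitK (inr _ a)). Qed.
Let two_basis_rr a j : two_basis (rshift q1 a) (inr j) = sum0_basis R a j.
Proof. by rewrite /two_basis (unsplitK (inr _ a)). Qed.

Lemma two_basis_combl (c : 'I_(q1 + q2) -> R) j :
  \sum_i c i * two_basis i (inl j) = \sum_a c (lshift q2 a) * sum0_basis R a j.
Proof.
rewrite big_split_ord /= [X in _ + X]big1 ?addr0 => [|a _].
  by apply: eq_bigr => a _; rewrite two_basis_ll.
by rewrite two_basis_rl mulr0.
Qed.

Lemma two_basis_combr (c : 'I_(q1 + q2) -> R) j :
  \sum_i c i * two_basis i (inr j) = \sum_a c (rshift q1 a) * sum0_basis R a j.
Proof.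
rewrite big_split_ord /= [X in X + _]big1 ?add0r => [|a _].
  by apply: eq_bigr => a _; rewrite two_basis_rr.
by rewrite two_basis_lr mulr0.
Qed.

Let coord (v : I -> R) (i : 'I_(q1 + q2)) : R :=
  match fintype.split i with
  | inl a => v (inl (enum_val a))
  | inr a => v (inr (enum_val a))
  end.

Let two_basis_span (v : I -> R) e : two_sum 0 0 v ->
  v e = \sum_i coord v i * two_basis i e.
Proof.
move=> [v1 v2]; case: e => j.
  rewrite two_basis_combl (sum0_basis_span (v := fun j => v (inl j)) j1)//.
  by apply: eq_bigr => a _; rewrite /coord (unsplitK (inl _ a)).
rewrite two_basis_combr (sum0_basis_span (v := fun j => v (inr j)) j2)//.
by apply: eq_bigr => a _; rewrite /coord (unsplitK (inr _ a)).
Qed.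

Lemma two_basis_zbasis : is_zbasis (two_sum 0 0) two_basis.
Proof.
split.
- move=> i; rewrite -(fintype.splitK i); case: (fintype.split i) => a /=; split.
  + split; first by under eq_bigr do rewrite two_basis_ll; rewrite sum0_basis_sum.
    by rewrite big1// => j _; rewrite two_basis_lr.
  + by case=> j; rewrite ?two_basis_ll ?two_basis_lr ?sum0_basis_int ?rpred0.
  + split; first by rewrite big1// => j _; rewrite two_basis_rl.
    by under eq_bigr do rewrite two_basis_rr; rewrite sum0_basis_sum.
  + by case=> j; rewrite ?two_basis_rl ?two_basis_rr ?sum0_basis_int ?rpred0.
- move=> c c0 i; rewrite -(fintype.splitK i); case: (fintype.split i) => a /=.
  + have := c0 (inl (enum_val a)); rewrite two_basis_combl.
    by rewrite (sum0_basis_comb (fun a => c (lshift q2 a))).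
  + have := c0 (inr (enum_val a)); rewrite two_basis_combr.
    by rewrite (sum0_basis_comb (fun a => c (rshift q1 a))).
- move=> v [Wv vint]; exists (fun i => Num.floor (coord v i)) => e.
  rewrite {1}(two_basis_span e Wv); apply: eq_bigr => i _; congr (_ * _).
  by rewrite floorK// /coord; case: fintype.split => a.
- by move=> v Wv; exists (coord v) => e; exact: two_basis_span.
Qed.

Lemma two_corner_sum c1 c2 : two_sum c1 c2 (two_corner c1 c2).
Proof. by split; rewrite /= -big_mkcond big_pred1_eq. Qed.

Lemma two_simplices_volume c1 c2 : 0 <= c1 -> 0 <= c2 ->
  volume_in (two_simplices c1 c2) two_basis (two_corner c1 c2) =
  (c1 ^+ q1 / q1`!%:R * (c2 ^+ q2 / q2`!%:R))%:E.
Proof.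
move=> c10 c20; rewrite -lebesgue_two_simplices//; congr lebesgue_tuple.
apply/funext => t /=; apply/propext.
set v := fun e => _.
have vl a : v (inl (enum_val a)) = tnth t (lshift q2 a).
  rewrite /v /= enum_val_predC1 add0r two_basis_combl.
  by rewrite (sum0_basis_comb (fun a => tnth t (lshift q2 a))).
have vr a : v (inr (enum_val a)) = tnth t (rshift q1 a).
  rewrite /v /= enum_val_predC1 add0r two_basis_combr.
  by rewrite (sum0_basis_comb (fun a => tnth t (rshift q1 a))).
have vl0 : v (inl j1) = c1 - \sum_a tnth t (lshift q2 a).
  by rewrite /v /= eqxx two_basis_combl sum0_basis_comb0.
have vr0 : v (inr j2) = c2 - \sum_a tnth t (rshift q1 a).
  by rewrite /v /= eqxx two_basis_combr sum0_basis_comb0.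
split.
  move=> [v0 _]; split.
  - move=> i; rewrite -(fintype.splitK i); case: (fintype.split i) => a /=.
      by rewrite -vl.
    by rewrite -vr.
  - by rewrite -subr_ge0 -vl0.
  - by rewrite -subr_ge0 -vr0.
move=> [t0 t1 t2]; split.
  case=> j.
    by case: (predC1P j1 j) => [->|[a ->]]; rewrite ?vl ?vl0 ?subr_ge0.
  by case: (predC1P j2 j) => [->|[a ->]]; rewrite ?vr ?vr0 ?subr_ge0.
split.
  rewrite (sum_predC1 j1) vl0 addrC.
  by under eq_bigr do rewrite vl; rewrite addrC subrK.
rewrite (sum_predC1 j2) vr0 addrC.
by under eq_bigr do rewrite vr; rewrite addrC subrK.
Qed.

End TwoSimplices.

(** * The cycle lemma *)

Section AffineTuple.
Variables (R : realType) (d : nat).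
Implicit Types f g : d.-tuple R -> R.

(** Closure under sums and differences yields measurability, and nullity of zero sets, for the
    partial sums below without computing their coefficients. *)
Definition affine_tuple f : Prop :=
  exists (c : R) (w : 'I_d -> R), forall t, f t = c + \sum_i tnth t i * w i.

Lemma affine_tuple_cst c : affine_tuple (fun=> c).
Proof. by exists c, (fun=> 0) => t; rewrite big1 ?addr0// => i _; rewrite mulr0. Qed.

Lemma affine_tupleD f g :
  affine_tuple f -> affine_tuple g -> affine_tuple (fun t => f t + g t).
Proof.
move=> [c [w fE]] [c' [w' gE]]; exists (c + c'), (fun i => w i + w' i) => t.
rewrite fE gE addrACA -big_split; congr (_ + _).
by apply: eq_bigr => i _; rewrite mulrDr.
Qed.

Lemma affine_tupleN f : affine_tuple f -> affine_tuple (fun t => - f t).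
Proof.
move=> [c [w fE]]; exists (- c), (fun i => - w i) => t.
by rewrite fE opprD -sumrN; congr (_ + _); apply: eq_bigr => i _; rewrite mulrN.
Qed.

Lemma affine_tupleB f g :
  affine_tuple f -> affine_tuple g -> affine_tuple (fun t => f t - g t).
Proof. by move=> af /affine_tupleN; exact: affine_tupleD. Qed.

Lemma affine_tuple_sum (K : Type) (r : seq K) (F : K -> d.-tuple R -> R) :
  (forall k, affine_tuple (F k)) -> affine_tuple (fun t => \sum_(k <- r) F k t).
Proof.
move=> aF; elim: r => [|k r IH].
  by under eq_fun do rewrite big_nil; exact: affine_tuple_cst.
by under eq_fun do rewrite big_cons; exact: affine_tupleD.
Qed.

Lemma measurable_affine_tuple_ge0 f :
  affine_tuple f -> measurable [set t | 0 <= f t].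
Proof.
move=> [c [w fE]]; under eq_fun do rewrite fE; exact: measurable_affine_ge0.
Qed.

Lemma measurable_affine_tuple_eq f g :
  affine_tuple f -> affine_tuple g -> measurable [set t | f t = g t].
Proof.
move=> af ag; have [c [w fE]] := affine_tupleB af ag.
have := measurable_affine_eq0 c w; congr measurable.
apply/funext => t /=; rewrite -fE; apply/propext; split; last by move=> ->; rewrite subrr.
by move=> /eqP; rewrite subr_eq0 => /eqP.
Qed.

(** Two points with different values certify that some coefficient is nonzero. *)
Lemma affine_tuple_null f t t' : affine_tuple f -> f t <> f t' ->
  lebesgue_tuple [set t | f t = 0] = 0%E.
Proof.
move=> [c [w fE]] ft; under eq_fun do rewrite fE.
have [[i wi]|w0] := pselect (exists i, w i != 0).
  exact: (lebesgue_tuple_hyperplane c wi).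
exfalso; apply: ft; rewrite !fE !big1// => i _.
  by have [->|wi] := eqVneq (w i) 0; rewrite ?mulr0//; case: w0; exists i.
by have [->|wi] := eqVneq (w i) 0; rewrite ?mulr0//; case: w0; exists i.
Qed.

End AffineTuple.

Section CyclicPrefix.
Variables (R : realType) (K : nat).
Implicit Types (u : 'I_K.+1 -> R) (c : 'I_K.+1).

(** Indices are read modulo [K.+1], so the partial sums continue past the end; they are periodic
    when the total is 0. *)
Definition prefix_sum u (n : nat) : R := \sum_(l < n) u (inZp l).

Lemma prefix_sum0 u : prefix_sum u 0 = 0. Proof. exact: big_ord0. Qed.

Lemma prefix_sumS u n : prefix_sum u n.+1 = prefix_sum u n + u (inZp n).
Proof. exact: big_ord_recr. Qed.

Lemma prefix_sum_full u : prefix_sum u K.+1 = \sum_i u i.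
Proof. by apply: eq_bigr => i _; rewrite valZpK. Qed.

Lemma prefix_sum_periodic u n : \sum_i u i = 0 ->
  prefix_sum u (n + K.+1) = prefix_sum u n.
Proof.
move=> u0; rewrite addnC /prefix_sum big_split_ord /=.
rewrite -[X in X + _]/(prefix_sum u K.+1) prefix_sum_full u0 add0r.
apply: eq_bigr => l _; congr u; apply: val_inj => /=.
by rewrite modnDl.
Qed.

Lemma prefix_sum_rot u c (i : 'I_K.+1) : \sum_i u i = 0 ->
  prefix_sum (fun l => u (l + c)) i = prefix_sum u ((i + c)%R : 'I_K.+1) - prefix_sum u c.
Proof.
move=> u0.
have -> : prefix_sum u ((i + c)%R : 'I_K.+1) = prefix_sum u (c + i)%N.
  have -> : nat_of_ord (i + c)%R = ((c + i) %% K.+1)%N by rewrite addnC.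
  (* If the window starting at [c] wraps around, one full period is removed; this is where the total
     being 0 enters. *)
  have [ci|ci] := ltnP (c + i) K.+1; first by rewrite modn_small.
  rewrite -(prefix_sum_periodic ((c + i) %% K.+1)%N u0); congr prefix_sum.
  have -> : ((c + i) %% K.+1 = c + i - K.+1)%N.
    rewrite -[in LHS](subnK ci) modnDr modn_small//.
    by rewrite ltn_subLR// -addSn leq_add// ltnW.
  by rewrite subnK.
rewrite /prefix_sum big_split_ord /= [X in _ = X - _]addrC addrK.
apply: eq_bigr => l _; congr u; apply: val_inj => /=.
by rewrite modnDml addnC.
Qed.

(** Starting the sequence at [c] subtracts the constant [prefix_sum u c] from the cyclically shifted
    partial sums, so nonnegativity turns into minimality at [c]. *)
Lemma prefix_sum_rot_ge0 u c : \sum_i u i = 0 ->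
  (forall i : 'I_K.+1, 0 <= prefix_sum (fun l => u (l + c)) i) <->
  (forall i : 'I_K.+1, prefix_sum u c <= prefix_sum u i).
Proof.
move=> u0; split => H i.
  by have := H (i - c); rewrite prefix_sum_rot// subrK subr_ge0.
by rewrite prefix_sum_rot// subr_ge0.
Qed.

(** A perturbation of total 0 that separates partial sums: the compensation sits at the last index,
    which no prefix of length at most [K] contains. *)
Lemma prefix_sum_bump u (z : R) c n : (n <= K)%N ->
  prefix_sum (fun l => u l - ((l == c)%:R - (l == ord_max)%:R) * z) n =
  prefix_sum u n - (c < n)%N%:R * z.
Proof.
elim: n => [_|n IH nK]; first by rewrite !prefix_sum0 mul0r subr0.
rewrite !prefix_sumS IH; last exact: ltnW.
have En (e : 'I_K.+1) : (inZp n == e) = (n == e).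
  by rewrite -val_eqE /= modn_small// ltnS ltnW.
rewrite !En /= (ltn_eqF nK) subr0.
have -> : (c < n.+1)%N%:R = (c < n)%N%:R + (n == c :> nat)%:R :> R.
  by rewrite ltnS leq_eqVlt -natrD eq_sym; case: ltngtP.
ring.
Qed.

End CyclicPrefix.

(** * The region of the free coordinates and its rotated copies *)

Section CarRegion.
Variables (R : realType) (k m : nat) (x y : R).
Hypotheses (x_gt0 : 0 < x) (y_ge0 : 0 <= y).
Let J1 : finType := ('I_k.+1 * 'I_m.+1)%type.
Let J2 : finType := 'I_m.+1.
Let I : finType := (J1 + J2)%type.
Implicit Types v : I -> R.

(** By conservation at a vertex, [row_excess] and [col_excess] are the increments of the flow along
    the two paths. *)
Definition row_excess (x0 : R) v (i : 'I_k.+1) : R := x0 - \sum_j v (inl (i, j)).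
Definition col_excess (y0 : R) v (j : 'I_m.+1) : R :=
  \sum_i v (inl (i, j)) + y0 - v (inr j).

Let c1 : R := k.+1%:R * x.
Let c2 : R := k.+1%:R * x + m.+1%:R * y.

(** At [c = c' = 0] the left-hand sides vanish and the inequalities express nonnegativity along the
    paths, so this piece corresponds to the flow polytope. *)
Definition car_region (c : 'I_k.+1) (c' : 'I_m.+1) : set (I -> R) :=
  [set v | [/\ two_simplices c1 c2 v,
    forall i : 'I_k.+1, prefix_sum (row_excess x v) c <= prefix_sum (row_excess x v) i &
    forall j : 'I_m.+1, prefix_sum (col_excess y v) c' <= prefix_sum (col_excess y v) j]].

Definition rot_index (c : 'I_k.+1) (c' : 'I_m.+1) (e : I) : I :=
  match e with inl (i, j) => inl (i + c, j + c') | inr j => inr (j + c') end.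

Lemma rot_indexK c c' : cancel (rot_index c c') (rot_index (- c) (- c')).
Proof. by case=> [[i j]|j] /=; rewrite !addrK. Qed.

Lemma rot_indexNK c c' : cancel (rot_index (- c) (- c')) (rot_index c c').
Proof. by case=> [[i j]|j] /=; rewrite !subrK. Qed.

Lemma sum_rot K (c : 'I_K.+1) (f : 'I_K.+1 -> R) : \sum_i f (i + c) = \sum_i f i.
Proof. by rewrite [RHS](reindex_inj (addIr c)). Qed.

Lemma row_excess_rot x0 c c' v i :
  row_excess x0 (v \o rot_index c c') i = row_excess x0 v (i + c).
Proof. by rewrite /row_excess /= (sum_rot c' (fun j => v (inl (i + c, j)))). Qed.

Lemma col_excess_rot y0 c c' v j :
  col_excess y0 (v \o rot_index c c') j = col_excess y0 v (j + c').
Proof. by rewrite /col_excess /= (sum_rot c (fun i => v (inl (i, j + c')))). Qed.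

Lemma sum_inl v : \sum_p v (inl p) = \sum_i \sum_j v (inl (i, j)).
Proof. by rewrite pair_bigA /=; apply: eq_bigr => -[]. Qed.

Lemma two_sum_rot a b c c' v :
  two_sum a b (v \o rot_index c c') <-> two_sum a b v.
Proof.
have S1 : \sum_p (v \o rot_index c c') (inl p) = \sum_p v (inl p).
  rewrite !sum_inl /=.
  under eq_bigr => i _ do rewrite (sum_rot c' (fun j => v (inl (i + c, j)))).
  by rewrite (sum_rot c (fun i => \sum_j v (inl (i, j)))).
have S2 : \sum_j (v \o rot_index c c') (inr j) = \sum_j v (inr j).
  exact: (sum_rot c' (fun j => v (inr j))).
by rewrite /two_sum /mkset S1 S2.
Qed.

Lemma row_excess_sum x0 v : \sum_i row_excess x0 v i = k.+1%:R * x0 - \sum_p v (inl p).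
Proof. by rewrite sum_inl sumrB sumr_const card_ord mulr_natl. Qed.

Lemma col_excess_sum y0 v : \sum_j col_excess y0 v j =
  \sum_p v (inl p) + m.+1%:R * y0 - \sum_j v (inr j).
Proof.
rewrite sum_inl exchange_big /= sumrB big_split /= sumr_const card_ord.
by rewrite [m.+1%:R * _]mulr_natl.
Qed.

(** Rotating the columns only reorders the sum within each row, and rotating the rows only the sum
    within each column. Each excess sequence therefore feels one of the two rotations. *)
Lemma car_region_rot c c' v :
  car_region c c' v <-> car_region 0 0 (v \o rot_index c c').
Proof.
have S : two_simplices c1 c2 (v \o rot_index c c') <-> two_simplices c1 c2 v.
  rewrite /two_simplices /= (propext (two_sum_rot _ _ _ _ _)).
  split=> -[v0 vs]; split=> //.
    by move=> e; rewrite -(rot_indexNK c c' e); exact: v0.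
rewrite /car_region /=.
have Er : row_excess x (v \o rot_index c c') = fun i => row_excess x v (i + c).
  by apply/funext => i; rewrite row_excess_rot.
have Ec : col_excess y (v \o rot_index c c') = fun j => col_excess y v (j + c').
  by apply/funext => j; rewrite col_excess_rot.
rewrite Er Ec !prefix_sum0.
split=> -[Sv r0 s0]; have /= [_ [v1 v2]] : two_simplices c1 c2 v by [|apply/S].
- by split; [apply/S|apply/prefix_sum_rot_ge0|apply/prefix_sum_rot_ge0] => //;
    rewrite ?row_excess_sum ?col_excess_sum v1 ?v2 subrr.
- by split; [apply/S|apply/prefix_sum_rot_ge0|apply/prefix_sum_rot_ge0] => //;
    rewrite ?row_excess_sum ?col_excess_sum v1 ?v2 subrr.
Qed.

Lemma two_sumB a b a' b' v v' : two_sum a b v -> two_sum a' b' v' ->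
  two_sum (a - a') (b - b') (fun e => v e - v' e).
Proof. by move=> [v1 v2] [v1' v2']; split; rewrite sumrB ?v1 ?v2 ?v1' ?v2'. Qed.

Lemma zbasis_rot c c' d (B : 'I_d -> I -> R) :
  is_zbasis (two_sum 0 0) B -> is_zbasis (two_sum 0 0) (fun i => B i \o rot_index c c').
Proof.
move=> [BW freeB spanZ spanR]; split.
- move=> i; have [WB Bint] := BW i; split; first exact/two_sum_rot.
  by move=> e; exact: Bint.
- move=> a a0; apply: freeB => e.
  by rewrite -(rot_indexNK c c' e); exact: a0.
- move=> v [Wv vint].
  have [|a aE] := spanZ (v \o rot_index (- c) (- c')).
    by split; [exact/two_sum_rot|move=> e; exact: vint].
  by exists a => e; rewrite -aE /= rot_indexK.
- move=> v Wv; have [|a aE] := spanR (v \o rot_index (- c) (- c')).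
    exact/two_sum_rot.
  by exists a => e; rewrite -aE /= rot_indexK.
Qed.

Let j1 : J1 := (ord0, ord0).
Let j2 : J2 := ord0.
Let B := @two_basis R J1 J2 j1 j2.
Let p := two_corner j1 j2 c1 c2.
Let d := (#|predC1 j1| + #|predC1 j2|)%N.
Let point (t : d.-tuple R) : I -> R := fun e => p e + \sum_i tnth t i * B i e.

Lemma affine_point e : affine_tuple (fun t => point t e).
Proof. by exists (p e), (fun i => B i e). Qed.

Lemma affine_row_prefix n : affine_tuple (fun t => prefix_sum (row_excess x (point t)) n).
Proof.
apply: affine_tuple_sum => l; apply: affine_tupleB; first exact: affine_tuple_cst.
by apply: affine_tuple_sum => j; exact: affine_point.
Qed.

Lemma affine_col_prefix n : affine_tuple (fun t => prefix_sum (col_excess y (point t)) n).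
Proof.
apply: affine_tuple_sum => l; apply: affine_tupleB; last exact: affine_point.
apply: affine_tupleD; last exact: affine_tuple_cst.
by apply: affine_tuple_sum => i; exact: affine_point.
Qed.

Lemma measurable_forall (T : finType) (F : T -> set (d.-tuple R)) :
  (forall c, measurable (F c)) -> measurable [set t | forall c, F c t].
Proof.
move=> mF; rewrite (_ : mkset _ = \big[setI/setT]_(c : T) F c).
  by apply: bigsetI_measurable.
rewrite -bigcap_seq; apply/seteqP; split => t /=; first by move=> H c _.
by move=> H c; apply: H; rewrite /= mem_index_enum.
Qed.

Lemma measurable_car_region c c' : measurable [set t | car_region c c' (point t)].
Proof.
have mle f g : affine_tuple f -> affine_tuple g ->
    measurable [set t : d.-tuple R | f t <= g t].
  move=> af ag; have := measurable_affine_tuple_ge0 (affine_tupleB ag af).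
  by under eq_fun do rewrite subr_ge0.
rewrite (_ : mkset _ =
  ([set t | forall e, 0 <= point t e] `&`
   ([set t | \sum_j point t (inl j) = c1] `&` [set t | \sum_j point t (inr j) = c2])) `&`
  ([set t | forall i : 'I_k.+1, prefix_sum (row_excess x (point t)) c <=
                       prefix_sum (row_excess x (point t)) i] `&`
   [set t | forall j : 'I_m.+1, prefix_sum (col_excess y (point t)) c' <=
                       prefix_sum (col_excess y (point t)) j])); last first.
  by apply/seteqP; split => t /= => [[[? [? ?]] ? ?]|[[? [? ?]] [? ?]]].
apply: measurableI; apply: measurableI.
- apply: (@measurable_forall _ (fun e => [set t | 0 <= point t e])) => e.
  exact: (measurable_affine_tuple_ge0 (affine_point e)).
- apply: measurableI; apply: measurable_affine_tuple_eq; try exact: affine_tuple_cst.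
    by apply: affine_tuple_sum => j; exact: affine_point.
  by apply: affine_tuple_sum => j; exact: affine_point.
- apply: (@measurable_forall _ (fun i : 'I_k.+1 => [set t |
    prefix_sum (row_excess x (point t)) c <= prefix_sum (row_excess x (point t)) i])) => i.
  by apply: mle; exact: affine_row_prefix.
- apply: (@measurable_forall _ (fun j : 'I_m.+1 => [set t |
    prefix_sum (col_excess y (point t)) c' <= prefix_sum (col_excess y (point t)) j])) => j.
  by apply: mle; exact: affine_col_prefix.
Qed.

(** The piece read in the basis [B] is the piece at 0 read in the rotated basis and origin.
    Permuting entries preserves integrality and both sum conditions, so this is again a lattice
    basis. *)
Lemma car_region_volume_rot c c' :
  volume_in (car_region c c') B p = volume_in (car_region 0 0) B p.
Proof.
have -> : volume_in (car_region c c') B p = volume_in (car_region 0 0)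
    (fun i => B i \o rot_index c c') (p \o rot_index c c').
  congr lebesgue_tuple; apply/funext => t /=; apply/propext.
  exact: car_region_rot.
have zB := two_basis_zbasis R j1 j2.
apply: (zbasis_volume zB (zbasis_rot c c' zB) _ (measurable_car_region 0 0)).2.
have ps := two_corner_sum j1 j2 c1 c2.
have := two_sumB ((two_sum_rot c1 c2 c c' p).2 ps) ps.
by rewrite !subrr.
Qed.

Lemma point_surj v : two_sum c1 c2 v -> exists t, point t = v.
Proof.
move=> vs; have [_ _ _ spanR] := two_basis_zbasis R j1 j2.
have [|a aE] := spanR (fun e => v e - p e).
  by have := two_sumB vs (two_corner_sum j1 j2 c1 c2); rewrite !subrr.
exists [tuple a i | i < d]; apply/funext => e.
rewrite /point; under eq_bigr do rewrite tnth_mktuple.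
by rewrite -aE addrC subrK.
Qed.

Lemma row_tie_null (c c0 : 'I_k.+1) : (c < c0)%N ->
  lebesgue_tuple [set t | prefix_sum (row_excess x (point t)) c0 -
                         prefix_sum (row_excess x (point t)) c = 0] = 0%E.
Proof.
move=> cc0.
(* Moves one unit in the first column from the last row to row [c]. Since [c < c0], this lowers the
   partial sum at [c0] by 1 and keeps the one at [c]. The points compared may have negative entries;
   only the sum conditions matter. *)
pose bump (e : I) : R := match e with
  | inl (i, j) => if j == ord0 then (i == c)%:R - (i == ord_max)%:R else 0
  | inr _ => 0 end.
have bump_row i : \sum_j bump (inl (i, j)) = (i == c)%:R - (i == ord_max)%:R.
  by rewrite (bigD1 ord0)//= big1 ?addr0// => j /negbTE ->.
have bump0 : \sum_q bump (inl q) = 0.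
  rewrite sum_inl; under eq_bigr do rewrite bump_row.
  rewrite sumrB (bigD1 c)//= big1 => [|i /negbTE ->//].
  rewrite (bigD1 ord_max)//= big1 => [|i /negbTE ->//].
  by rewrite !eqxx !addr0 subrr.
have [t tE] : exists t, point t = fun e => p e + bump e.
  apply: point_surj; have [p1 p2] := two_corner_sum j1 j2 c1 c2.
  split; rewrite big_split /= ?p1 ?p2; last by rewrite big1 ?addr0.
  by rewrite [X in _ + X]bump0 addr0.
have [t' t'E] : exists t, point t = p by apply: point_surj; exact: two_corner_sum.
apply: (@affine_tuple_null _ _ _ t t').
  by apply: affine_tupleB; exact: affine_row_prefix.
have -> : row_excess x (point t) =
    fun i => row_excess x p i - ((i == c)%:R - (i == ord_max)%:R) * 1.
  by apply/funext => i; rewrite tE /row_excess big_split /= bump_row mulr1 opprD addrA.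
rewrite t'E !prefix_sum_bump ?leq_ord//.
rewrite cc0 ltnn mul0r subr0 mul1r => /eqP.
by rewrite -subr_eq0 opprB addrA subrK addrAC subrr sub0r oppr_eq0 oner_eq0.
Qed.

Lemma col_tie_null (c c0 : 'I_m.+1) : (c < c0)%N ->
  lebesgue_tuple [set t | prefix_sum (col_excess y (point t)) c0 -
                         prefix_sum (col_excess y (point t)) c = 0] = 0%E.
Proof.
move=> cc0.
(* Here the unit moves within the sink edges alone, so the column sums of the matrix stay fixed. *)
pose bump (e : I) : R := match e with
  | inl _ => 0
  | inr j => (j == c)%:R - (j == ord_max)%:R end.
have [t tE] : exists t, point t = fun e => p e + bump e.
  apply: point_surj; have [p1 p2] := two_corner_sum j1 j2 c1 c2.
  split; rewrite big_split /= ?p1 ?p2; first by rewrite big1 ?addr0.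
  rewrite sumrB (bigD1 c)//= big1 => [|i /negbTE ->//].
  rewrite (bigD1 ord_max)//= big1 => [|i /negbTE ->//].
  by rewrite !eqxx !addr0 subrr addr0.
have [t' t'E] : exists t, point t = p by apply: point_surj; exact: two_corner_sum.
apply: (@affine_tuple_null _ _ _ t t').
  by apply: affine_tupleB; exact: affine_col_prefix.
have -> : col_excess y (point t) =
    fun i => col_excess y p i - ((i == c)%:R - (i == ord_max)%:R) * 1.
  apply/funext => i; rewrite tE /col_excess big_split /= big1_eq addr0.
  by rewrite mulr1 opprD addrA.
rewrite t'E !prefix_sum_bump ?leq_ord//.
rewrite cc0 ltnn mul0r subr0 mul1r => /eqP.
by rewrite -subr_eq0 opprB addrA subrK addrAC subrr sub0r oppr_eq0 oner_eq0.
Qed.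

(** Two minimisers of one sequence give equal partial sums, hence a null tie set. The measurable set
    [A] is kept apart from the [F c], which in the applications are unions over the index of the
    other sequence. *)
Lemma prefix_tie K (g : d.-tuple R -> nat -> R) (F : 'I_K.+1 -> set (d.-tuple R))
    (c c0 : 'I_K.+1) :
  (forall n, affine_tuple (fun t => g t n)) ->
  (forall c, F c `<=` [set t | forall i : 'I_K.+1, g t c <= g t i]) ->
  (forall c c0 : 'I_K.+1, (c < c0)%N -> lebesgue_tuple [set t | g t c0 - g t c = 0] = 0%E) ->
  c != c0 -> forall A, measurable A -> A `<=` F c `&` F c0 -> lebesgue_tuple A = 0%E.
Proof.
move=> ag Fg g0 cc0 A mA AF.
have tie t : A t -> g t c = g t c0.
  move=> /AF[/Fg tc /Fg tc0]; apply/eqP; rewrite eq_le.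
  by rewrite (tc c0) (tc0 c).
have Q (a b : 'I_K.+1) : (a < b)%N -> A `<=` [set t | g t b - g t a = 0] ->
    lebesgue_tuple A = 0%E.
  move=> ab Aab; apply: (@subset_measure0 _ _ _ (@lebesgue_tuple R d) _ _ mA _ Aab).
    by apply: measurable_affine_tuple_eq; [exact: affine_tupleB|exact: affine_tuple_cst].
  exact: g0.
have [lt|lt|/val_inj E] := ltngtP c c0; last by rewrite E eqxx in cc0.
- by apply: (Q c c0) => // t /tie; rewrite /= => ->; rewrite subrr.
- by apply: (Q c0 c) => // t /tie; rewrite /= => ->; rewrite subrr.
Qed.

Lemma car_region_volume :
  volume_in (car_region 0 0) B p =
  (c1 ^+ (k.+1 * m.+1).-1 / (k.+1 * m.+1).-1`!%:R * (c2 ^+ m / m`!%:R)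
     / (k.+1 * m.+1)%:R)%:E.
Proof.
have c10 : 0 <= c1 by rewrite mulr_ge0// ltW.
have c20 : 0 <= c2 by rewrite addr_ge0// mulr_ge0.
have E1 : #|predC1 j1| = (k.+1 * m.+1).-1 by rewrite cardC1 card_prod !card_ord.
have E2 : #|predC1 j2| = m by rewrite cardC1 card_ord.
have VE : volume_in (two_simplices c1 c2) B p =
    (c1 ^+ (k.+1 * m.+1).-1 / (k.+1 * m.+1).-1`!%:R * (c2 ^+ m / m`!%:R))%:E.
  by rewrite [LHS](two_simplices_volume j1 j2 c10 c20) E1 E2.
have cover : volume_in (two_simplices c1 c2) B p =
    (\sum_(cc : 'I_k.+1 * 'I_m.+1) volume_in (car_region cc.1 cc.2) B p)%E.
  rewrite -(@measure_ae_disjoint_union R _ _ (@lebesgue_tuple R d) _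
     (fun cc => [set t | car_region cc.1 cc.2 (point t)])).
  - congr lebesgue_tuple; apply/funext => t /=; apply/propext; split; last by move=> [cc []].
    move=> St.
    (* Every point of the product lies in some piece because a finite sequence attains its
       minimum. *)
    have [c _ cmin] := @arg_minP _ R _ (ord0 : 'I_k.+1) xpredT
       (fun i => prefix_sum (row_excess x (point t)) i) isT.
    have [c' _ cmin'] := @arg_minP _ R _ (ord0 : 'I_m.+1) xpredT
       (fun i => prefix_sum (col_excess y (point t)) i) isT.
    by exists (c, c'); split => // i; [exact: cmin|exact: cmin'].
  - by move=> cc; exact: measurable_car_region.
  - move=> [c c'] [c0 c0'] ne.
    have mI := measurableI _ _ (measurable_car_region c c') (measurable_car_region c0 c0').
    (* Distinct pairs differ in at least one index; a tie in the corresponding sequence makes the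
       overlap null. *)
    have [E|cc0] := eqVneq c c0.
      have cc0' : c' != c0' by apply: contra_neq ne => ->; rewrite E.
      apply: (@prefix_tie m (fun t => prefix_sum (col_excess y (point t)))
        (fun c' t => exists c, car_region c c' (point t)) c' c0') => //.
      + exact: affine_col_prefix.
      + by move=> a t [? []].
      + exact: col_tie_null.
      + by move=> t /= [? ?]; split; [exists c|exists c0].
    apply: (@prefix_tie k (fun t => prefix_sum (row_excess x (point t)))
        (fun c t => exists c', car_region c c' (point t)) c c0) => //.
    + exact: affine_row_prefix.
    + by move=> a t [? []].
    + exact: row_tie_null.
    + by move=> t /= [? ?]; split; [exists c'|exists c0'].
move: cover; rewrite VE.
under eq_bigr do rewrite car_region_volume_rot.
rewrite sumr_const card_prod !card_ord.
have N0 : (k.+1 * m.+1)%:R != 0 :> R by rewrite pnatr_eq0.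
have : (0 <= volume_in (car_region ord0 ord0) B p)%E.
  exact: (measure_ge0 (@lebesgue_tuple R d) [set t | car_region ord0 ord0 (point t)]).
have natmulE (z : \bar R) n : z *+ n = enatmul z n by [].
rewrite -[car_region 0 0]/(car_region ord0 ord0).
(* The volume of the piece is an extended real; it is finite because a positive multiple of it
   is. *)
case: (volume_in (car_region ord0 ord0) B p) => [r _|_|//].
  rewrite natmulE -EFin_natmul => -[->]; congr EFin.
  by rewrite -[r *+ _]mulr_natr mulfK.
by rewrite mulSn addSn natmulE enatmul_pinfty.
Qed.

End CarRegion.

(** * Flows on the car graph *)

Section CarFlow.
Variables (R : realType) (k m : nat).
Let N := (k.+1 + m.+1)%N.
Let NE : N = (k.+1 + m.+1)%N := erefl.
Let E := edge (car_graph k.+1 N).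
Let I : finType := (('I_k.+1 * 'I_m.+1) + 'I_m.+1)%type.
Implicit Types (f g : E -> R) (v : I -> R).

(** Extending a flow by 0 to all pairs of naturals lets sums over edges be written as sums over
    vertices. *)
Definition edge_flow f (i j : nat) : R :=
  \sum_(e : E | ((val e).1 == i :> nat) && ((val e).2 == j :> nat)) f e.

Lemma edge_flowE f (e : E) : edge_flow f (val e).1 (val e).2 = f e.
Proof.
rewrite /edge_flow (big_pred1 e)// => e' /=.
Qed.

Lemma edge_flow_none f i j : ~~ car_edge k.+1 N i.+1 j.+1 -> edge_flow f i j = 0.
Proof.
move=> ne; rewrite /edge_flow big1// => e /andP[/eqP ei /eqP ej].
by have := valP e; rewrite inE ei ej (negbTE ne).
Qed.

Lemma edge_flow_fun (g : nat -> nat -> R) i j : car_edge k.+1 N i.+1 j.+1 ->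
  edge_flow (fun e => g (val e).1 (val e).2) i j = g i j.
Proof.
move=> ce.
have iN : (i < N.+1)%N by move: ce; rewrite /car_edge; lia.
have jN : (j < N.+1)%N by move: ce; rewrite /car_edge; lia.
have eP : (Ordinal iN, Ordinal jN) \in car_graph k.+1 N by rewrite inE.
exact: (edge_flowE (fun e => g (val e).1 (val e).2) (Sub (Ordinal iN, Ordinal jN) eP : E)).
Qed.

Lemma edge_flow_out f (i : 'I_N.+1) :
  \sum_(e : E | (val e).1 == i) f e = \sum_(l < N.+1) edge_flow f i l.
Proof.
rewrite (partition_big (fun e : E => (val e).2) xpredT)//.
Qed.

Lemma edge_flow_in f (i : 'I_N.+1) :
  \sum_(e : E | (val e).2 == i) f e = \sum_(l < N.+1) edge_flow f l i.
Proof.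
rewrite (partition_big (fun e : E => (val e).1) xpredT)//=.
by apply: eq_bigr => l _; apply: eq_bigl => e; rewrite -!val_eqE andbC.
Qed.

Definition netflow f (i : 'I_N.+1) : R :=
  \sum_(e : E | (val e).1 == i) f e - \sum_(e : E | (val e).2 == i) f e.

Definition is_flow (x y : R) f : Prop :=
  forall i : 'I_N.+1, (i < N)%N -> netflow f i = car_netflow k.+1 N x y i.

(* The values of a flow on the two paths 1 -> ... -> k and k+1 -> ... -> n,
   extended by 0 at both ends. *)
Definition row_path f (i : nat) : R :=
  if (0 < i < k.+1)%N then edge_flow f i.-1 i else 0.
Definition col_path f (j : nat) : R :=
  if (0 < j < m.+1)%N then edge_flow f (k.+1 + j.-1) (k.+1 + j) else 0.

(** The edge from the last row vertex to the first column vertex, and the one from the last column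
    vertex to the sink, are counted here. The graph has no multiple edges, so the two paths stop
    just before them. *)
Definition free_edges f (e : I) : R :=
  match e with
  | inl (i, j) => edge_flow f i (k.+1 + j)
  | inr j => edge_flow f (k.+1 + j) N
  end.

Lemma sum_single n (F : nat -> R) (l0 : nat) : (forall l, (l < n)%N -> l != l0 -> F l = 0) ->
  \sum_(l < n) F l = if (l0 < n)%N then F l0 else 0.
Proof.
move=> F0; case: ifPn => [ln|nl].
  rewrite (bigD1 (Ordinal ln))//= big1 ?addr0// => l; rewrite -val_eqE /=.
  exact: F0.
by rewrite big1// => l _; apply: F0 => //; apply: contraNneq nl => <-.
Qed.

Lemma sum_vertices (F : nat -> R) : \sum_(l < N.+1) F l =
  \sum_(l < k.+1) F l + \sum_(l < m.+1) F (k.+1 + l)%N + F N.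
Proof. by rewrite big_ord_recr /= big_split_ord. Qed.

Lemma inflow_row f i : (i < k.+1)%N ->
  \sum_(l < N.+1) edge_flow f l i = row_path f i.
Proof.
move=> ik; rewrite /row_path; case: ifPn => [|i0].
  move=> /andP[i0 _]; rewrite (@sum_single _ (fun l => edge_flow f l i) i.-1).
    by rewrite ifT//; lia.
  by move=> l lN li; apply: edge_flow_none; rewrite /car_edge; lia.
by rewrite big1// => l _; apply: edge_flow_none; rewrite /car_edge; lia.
Qed.

Lemma netflow_row f (i : 'I_N.+1) (ik : (i < k.+1)%N) :
  netflow f i = row_path f i.+1 - row_path f i +
     \sum_j free_edges f (inl (Ordinal ik, j)).
Proof.
rewrite /netflow edge_flow_out edge_flow_in inflow_row//.
rewrite sum_vertices (@sum_single _ (edge_flow f i) i.+1); last first.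
  by move=> l lk li; apply: edge_flow_none; rewrite /car_edge; lia.
rewrite -/(row_path f i.+1) [edge_flow f i N]edge_flow_none; last first.
  by rewrite /car_edge; lia.
by rewrite addr0 addrAC.
Qed.

Lemma inflow_col f j : (j < m.+1)%N ->
  \sum_(l < N.+1) edge_flow f l (k.+1 + j) =
  \sum_(i < k.+1) edge_flow f i (k.+1 + j) + col_path f j.
Proof.
move=> jm; rewrite (sum_vertices (fun l => edge_flow f l (k.+1 + j))) -addrA; congr (_ + _).
rewrite [X in _ + X]edge_flow_none ?addr0; last by rewrite /car_edge; lia.
rewrite /col_path; case: ifPn => [|j0].
  move=> /andP[j0 _]; rewrite (@sum_single _ (fun l => edge_flow f (k.+1 + l) (k.+1 + j)) j.-1).
    by rewrite ifT//; lia.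
  by move=> l lN li; apply: edge_flow_none; rewrite /car_edge; lia.
by rewrite big1// => l _; apply: edge_flow_none; rewrite /car_edge; lia.
Qed.

Lemma netflow_col f (i : 'I_N.+1) (j : 'I_m.+1) : i = (k.+1 + j)%N :> nat ->
  netflow f i = col_path f j.+1 - col_path f j + free_edges f (inr j)
     - \sum_i0 free_edges f (inl (i0, j)).
Proof.
move=> ij; rewrite /netflow edge_flow_out edge_flow_in ij inflow_col//.
rewrite sum_vertices [X in X + _ + _ - _]big1 ?add0r; last first.
  by move=> l _; apply: edge_flow_none; have := ltn_ord l; rewrite /car_edge; lia.
rewrite (@sum_single _ (fun l => edge_flow f (k.+1 + j) (k.+1 + l)) j.+1); last first.
  by move=> l lk li; apply: edge_flow_none; rewrite /car_edge; lia.
rewrite -[X in X + _ - _]/(col_path f j.+1) /=; ring.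
Qed.

(** Conservation prescribes the increments of the path values, which start at 0. The full lengths
    [k.+1] and [m.+1] are included: there the path value is again 0, which encodes the two sum
    conditions. *)
Lemma is_flowP x y f : is_flow x y f <->
  (forall n, (n <= k.+1)%N -> row_path f n = prefix_sum (row_excess x (free_edges f)) n) /\
  (forall n, (n <= m.+1)%N -> col_path f n = prefix_sum (col_excess y (free_edges f)) n).
Proof.
have inZpE K (l : 'I_K.+1) n : n = l :> nat -> inZp n = l.
  by move=> ->; rewrite valZpK.
split.
  move=> fl; split; elim=> [_|n IH nk].
  - by rewrite prefix_sum0.
  - rewrite prefix_sumS -IH; last exact: ltnW.
    have nN : (n < N.+1)%N by lia.
    have := fl (Ordinal nN); rewrite (@netflow_row f (Ordinal nN) nk) /car_netflow /= nk.
    rewrite (_ : (n < N)%N = true); last by lia.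
    move=> /(_ isT) <-; rewrite /row_excess (@inZpE _ (Ordinal nk))//=; ring.
  - by rewrite prefix_sum0.
  - rewrite prefix_sumS -IH; last exact: ltnW.
    have nN : (k.+1 + n < N.+1)%N by lia.
    have := fl (Ordinal nN).
    rewrite (@netflow_col f (Ordinal nN) (Ordinal nk) erefl) /car_netflow /=.
    rewrite ifF; last by lia.
    rewrite (_ : (k.+1 + n < N)%N = true); last by lia.
    move=> /(_ isT) E0; rewrite /col_excess (@inZpE _ (Ordinal nk))// -E0 /=; ring.
move=> [rE cE] i iN; rewrite /car_netflow iN; case: ifPn => [ik|ik].
  rewrite (netflow_row f ik) !rE ?prefix_sumS; [|lia|lia].
  rewrite /row_excess (@inZpE _ (Ordinal ik))//; ring.
have jm : (i - k.+1 < m.+1)%N by lia.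
rewrite (@netflow_col f i (Ordinal jm)) ?cE ?prefix_sumS /=; [|lia|lia|lia].
rewrite /col_excess (@inZpE _ (Ordinal jm))//=; ring.
Qed.

Lemma is_flow_two_sum x y f : is_flow x y f ->
  two_sum (k.+1%:R * x) (k.+1%:R * x + m.+1%:R * y) (free_edges f).
Proof.
move=> /is_flowP[/(_ _ (leqnn _)) rE /(_ _ (leqnn _)) cE].
move: rE cE; rewrite !prefix_sum_full /row_path /col_path !ltnn !andbF.
rewrite row_excess_sum col_excess_sum => /esym /eqP; rewrite subr_eq0 => /eqP E1.
move=> /esym /eqP; rewrite subr_eq0 => /eqP E2.
by split; rewrite ?E1 ?E2.
Qed.

(** The inverse of [free_edges]: path values are recovered as partial sums. Natural indices make
    [edge_flow_fun] applicable. *)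
Definition complete_flow_nat (x y : R) v (i j : nat) : R :=
  if (i < k.+1)%N then
    if (k.+1 <= j)%N then v (inl (inZp i, inZp (j - k.+1)))
    else prefix_sum (row_excess x v) j
  else if j == N then v (inr (inZp (i - k.+1)))
  else prefix_sum (col_excess y v) (j - k.+1).

Definition complete_flow (x y : R) v (e : E) : R :=
  complete_flow_nat x y v (val e).1 (val e).2.

Lemma complete_flow_free x y v : free_edges (complete_flow x y v) = v.
Proof.
apply/funext => -[[i j]|j] /=.
  rewrite edge_flow_fun; last first.
    by have := ltn_ord i; have := ltn_ord j; rewrite /car_edge; lia.
  by rewrite /complete_flow_nat ltn_ord leq_addr addKn !valZpK.
rewrite edge_flow_fun; last first.
  by have := ltn_ord j; rewrite /car_edge; lia.
rewrite /complete_flow_nat eqxx ifF; last lia.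
by rewrite addKn valZpK.
Qed.

Lemma complete_flowP x y v :
  two_sum (k.+1%:R * x) (k.+1%:R * x + m.+1%:R * y) v -> is_flow x y (complete_flow x y v).
Proof.
move=> [v1 v2]; apply/is_flowP; rewrite complete_flow_free; split => n nk.
  rewrite /row_path; case: ifPn => [n0|n0].
    rewrite edge_flow_fun; last by rewrite /car_edge; lia.
    by rewrite /complete_flow_nat ifT; [rewrite ifF//; lia|lia].
  have [->|->] : n = 0%N \/ n = k.+1 by lia.
    by rewrite prefix_sum0.
  by rewrite prefix_sum_full row_excess_sum v1 subrr.
rewrite /col_path; case: ifPn => [n0|n0].
  rewrite edge_flow_fun; last by rewrite /car_edge; lia.
  rewrite /complete_flow_nat ifF; last lia.
  by rewrite ifF ?addKn//; lia.
have [->|->] : n = 0%N \/ n = m.+1 by lia.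
  by rewrite prefix_sum0.
by rewrite prefix_sum_full col_excess_sum v1 v2 subrr.
Qed.

Lemma complete_flowK x y f : is_flow x y f -> complete_flow x y (free_edges f) = f.
Proof.
move=> /is_flowP[rE cE]; apply/funext => e; rewrite -[RHS]edge_flowE /complete_flow.
have : car_edge k.+1 N (val e).1.+1 (val e).2.+1 by have := valP e; rewrite inE.
move: (nat_of_ord (val e).1) (nat_of_ord (val e).2) => i j ce; rewrite /complete_flow_nat.
case: ifPn => ik.
  case: ifPn => jk /=.
    have jm : (j - k.+1 < m.+1)%N by move: ce; rewrite /car_edge; lia.
    by rewrite !modn_small//; congr edge_flow; lia.
  have ij : j = i.+1 by move: ce; rewrite /car_edge; lia.
  by rewrite -rE; [rewrite /row_path ij ifT//=; lia|lia].
have im : (i - k.+1 < m.+1)%N by move: ce; rewrite /car_edge; lia.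
case: ifPn => jN /=.
  by rewrite modn_small//; congr edge_flow; lia.
have ij : j = i.+1 by move: ce; rewrite /car_edge; lia.
rewrite -cE; last by move: ce jN; rewrite /car_edge; lia.
rewrite /col_path ifT; last by move: ce jN; rewrite /car_edge; lia.
by congr edge_flow; lia.
Qed.

Lemma free_edges_inj x y f g : is_flow x y f -> is_flow x y g ->
  free_edges f = free_edges g -> f = g.
Proof. by move=> ff fg fgE; rewrite -(complete_flowK ff) fgE (complete_flowK fg). Qed.

Lemma edge_flow_comb d (c : 'I_d -> R) (F : 'I_d -> E -> R) f i j :
  edge_flow (fun e => f e + \sum_l c l * F l e) i j =
  edge_flow f i j + \sum_l c l * edge_flow (F l) i j.
Proof.
rewrite /edge_flow big_split /=; congr (_ + _); rewrite exchange_big /=.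
by apply: eq_bigr => l _; rewrite mulr_sumr.
Qed.

Lemma free_edges_comb d (c : 'I_d -> R) (F : 'I_d -> E -> R) f :
  free_edges (fun e => f e + \sum_l c l * F l e) =
  fun e => free_edges f e + \sum_l c l * free_edges (F l) e.
Proof. by apply/funext => -[[i j]|j] /=; rewrite edge_flow_comb. Qed.

Lemma free_edges_comb0 d (c : 'I_d -> R) (F : 'I_d -> E -> R) :
  free_edges (fun e => \sum_l c l * F l e) =
  fun e => \sum_l c l * free_edges (F l) e.
Proof.
have := free_edges_comb c F (fun=> 0).
under [in LHS]eq_fun do rewrite add0r.
move=> ->; apply/funext => e; rewrite [X in X + _](_ : _ = 0) ?add0r//.
by case: e => [[i j]|j] /=; rewrite /edge_flow big1.
Qed.

Lemma car_netflow00 (i : 'I_N.+1) : (i < N)%N -> car_netflow k.+1 N 0 0 i = 0 :> R.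
Proof. by move=> iN; rewrite /car_netflow iN; case: ifP. Qed.

Lemma is_flow_comb x y d (c : 'I_d -> R) (F : 'I_d -> E -> R) f :
  is_flow x y f -> (forall l, is_flow 0 0 (F l)) ->
  is_flow x y (fun e => f e + \sum_l c l * F l e).
Proof.
move=> fl Fl i iN; rewrite -(fl i iN) /netflow !big_split /= opprD addrACA -[RHS]addr0.
congr (_ + _); rewrite exchange_big [X in _ - X]exchange_big /= -sumrB big1// => l _.
rewrite -!mulr_sumr -mulrBr (_ : _ - _ = 0) ?mulr0//.
by have := Fl l i iN; rewrite car_netflow00.
Qed.

Lemma is_flow00 : is_flow 0 0 (fun=> 0).
Proof. by move=> i iN; rewrite car_netflow00// /netflow !big1// subrr. Qed.

Lemma is_flow_comb0 d (c : 'I_d -> R) (F : 'I_d -> E -> R) :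
  (forall l, is_flow 0 0 (F l)) -> is_flow 0 0 (fun e => \sum_l c l * F l e).
Proof.
move=> Fl; have := is_flow_comb c is_flow00 Fl.
by under eq_fun do rewrite add0r.
Qed.

Lemma flow_two_sum00 f : is_flow 0 0 f -> two_sum 0 0 (free_edges f).
Proof. by move=> /is_flow_two_sum; rewrite !mulr0 addr0. Qed.

Lemma complete_flow00P v : two_sum 0 0 v -> is_flow 0 0 (complete_flow 0 0 v).
Proof. by move=> Wv; apply: complete_flowP; rewrite !mulr0 addr0. Qed.

Lemma free_edges_int f : (forall e, f e \is a Num.int) ->
  forall e, free_edges f e \is a Num.int.
Proof. by move=> fZ [[i j]|j] /=; apply: rpred_sum. Qed.

Lemma complete_flow_int v : (forall e, v e \is a Num.int) ->
  forall e, complete_flow 0 0 v e \is a Num.int.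
Proof.
move=> vZ e; rewrite /complete_flow /complete_flow_nat.
case: ifP => _; case: ifP => _ //; apply: rpred_sum => l _.
  by rewrite rpredB ?rpred0// rpred_sum.
by rewrite rpredB// rpredD ?rpred0// rpred_sum.
Qed.

(** [free_edges] is a linear bijection from flows with zero net flow onto vectors with both sums
    zero. It is integral both ways, since partial sums of integers are integers. *)
Lemma zbasis_free_edges d (B : 'I_d -> E -> R) : is_zbasis (is_flow 0 0) B ->
  is_zbasis (two_sum 0 0) (fun i => free_edges (B i)).
Proof.
move=> [BW freeB spanZ spanR].
have span v c : two_sum 0 0 v ->
    (forall e, complete_flow 0 0 v e = \sum_(i < d) c i * B i e) ->
    forall e, v e = \sum_(i < d) c i * free_edges (B i) e.
  move=> Wv /funext cE e.
  by rewrite -[in LHS](complete_flow_free 0 0 v) cE free_edges_comb0.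
split.
- move=> i; have [Bi BZ] := BW i; split; first exact: flow_two_sum00.
  exact: free_edges_int.
- move=> c c0; apply: freeB => e.
  rewrite -[RHS]/((fun=> 0) e); move: e; apply/funeqP.
  apply: (@free_edges_inj 0 0); [|exact: is_flow00|].
    by apply: is_flow_comb0 => i; exact: (BW i).1.
  rewrite free_edges_comb0; apply/funext => e; rewrite c0.
  by case: e => [[i j]|j] /=; rewrite /edge_flow big1.
- move=> v [Wv vZ]; have [|c cE] := spanZ (complete_flow 0 0 v).
    by split; [exact: complete_flow00P|exact: complete_flow_int].
  by exists c; exact: (span _ (fun i => (c i)%:~R)).
- move=> v Wv; have [|c cE] := spanR (complete_flow 0 0 v); first exact: complete_flow00P.
  by exists c; exact: span.
Qed.

Lemma zbasis_complete_flow d (B : 'I_d -> I -> R) : is_zbasis (two_sum 0 0) B ->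
  is_zbasis (is_flow 0 0) (fun i => complete_flow 0 0 (B i)).
Proof.
move=> [BW freeB spanZ spanR].
have flB i : is_flow 0 0 (complete_flow 0 0 (B i)) by apply: complete_flow00P; exact: (BW i).1.
have freeE c : free_edges (fun e => \sum_i c i * complete_flow 0 0 (B i) e) =
    fun e => \sum_i c i * B i e.
  rewrite free_edges_comb0; apply/funext => e.
  by apply: eq_bigr => i _; rewrite complete_flow_free.
have span f c : is_flow 0 0 f ->
    (forall e, free_edges f e = \sum_(i < d) c i * B i e) ->
    forall e, f e = \sum_(i < d) c i * complete_flow 0 0 (B i) e.
  move=> fl cE; apply/funeqP; apply: (@free_edges_inj 0 0) => //.
    exact: is_flow_comb0.
  by rewrite freeE; apply/funext.
split.
- move=> i; split=> //; apply: complete_flow_int; exact: (BW i).2.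
- move=> c /funext c0; apply: freeB => e.
  rewrite -[LHS]/((fun e => \sum_i c i * B i e) e) -freeE c0.
  by case: e => [[i j]|j] /=; rewrite /edge_flow big1.
- move=> f [fl fZ]; have [|c cE] := spanZ (free_edges f).
    by split; [exact: flow_two_sum00|exact: free_edges_int].
  by exists c; exact: (span _ (fun i => (c i)%:~R)).
- move=> f fl; have [|c cE] := spanR (free_edges f); first exact: flow_two_sum00.
  by exists c; exact: span.
Qed.

Variables (x y : R).
Let P := flow_polytope (car_graph k.+1 N) (car_netflow k.+1 N x y).

(** Every edge is free or on a path, so nonnegativity of [f] splits into that of the free
    coordinates and that of the partial sums. *)
Lemma flow_polytope_region f : is_flow x y f ->
  P f <-> car_region x y ord0 ord0 (free_edges f).
Proof.
move=> fl; have [rE cE] := (is_flowP x y f).1 fl.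
have ef0 : (forall e, 0 <= f e) -> forall i j, 0 <= edge_flow f i j.
  by move=> f0 i j; apply: sumr_ge0.
split.
  move=> [f0 _]; split.
  - split; last exact: is_flow_two_sum.
    by move=> [[i j]|j] /=; exact: ef0.
  - move=> i; rewrite prefix_sum0 -rE; last exact: ltnW.
    by rewrite /row_path; case: ifP => // _; exact: ef0.
  - move=> j; rewrite prefix_sum0 -cE; last exact: ltnW.
    by rewrite /col_path; case: ifP => // _; exact: ef0.
move=> [[f0 _] r0 c0]; split=> // e.
rewrite -(complete_flowK fl) /complete_flow /complete_flow_nat.
have : car_edge k.+1 N (val e).1.+1 (val e).2.+1 by have := valP e; rewrite inE.
move: (nat_of_ord (val e).1) (nat_of_ord (val e).2) => i j ce.
case: ifPn => ik; case: ifPn => jk //.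
  have jk' : (j < k.+1)%N by lia.
  by have := r0 (Ordinal jk'); rewrite prefix_sum0.
have jm : (j - k.+1 < m.+1)%N by move: ce jk; rewrite /car_edge; lia.
by have := c0 (Ordinal jm); rewrite prefix_sum0.
Qed.

End CarFlow.

(** * The direction of the flow polytope and its volume *)

Section Direction.
Variables (R : realType) (k m : nat) (x y : R).
Hypotheses (x_gt0 : 0 < x) (y_ge0 : 0 <= y).
Let N := (k.+1 + m.+1)%N.
Let NE : N = (k.+1 + m.+1)%N := erefl.
Let E := edge (car_graph k.+1 N).
Let I : finType := (('I_k.+1 * 'I_m.+1) + 'I_m.+1)%type.
Let P := flow_polytope (car_graph k.+1 N) (car_netflow k.+1 N x y).

(* Half of each unit of supply z is postponed to the last index. *)
Definition half_late K (z : R) (l : 'I_K.+1) : R :=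
  z / 2 + (l == ord_max)%:R * (K.+1%:R * z / 2).

Lemma half_late_gt0 K z (l : 'I_K.+1) : 0 < z -> 0 < half_late z l.
Proof.
move=> z0; have z2 : 0 < z / 2 by rewrite divr_gt0.
by rewrite ltr_pwDl// mulr_ge0// divr_ge0// mulr_ge0// ltW.
Qed.

Lemma half_late_sum K z : \sum_(l < K.+1) half_late z l = K.+1%:R * z :> R.
Proof.
rewrite big_split /= sumr_const card_ord -mulr_suml (bigD1 ord_max)//= big1.
  by rewrite eqxx addr0 mul1r -[_ *+ _]mulr_natl; field.
by move=> l /negbTE ->.
Qed.

Lemma half_late_prefix K z n : (n <= K)%N ->
  prefix_sum (fun l : 'I_K.+1 => z - half_late z l) n = n%:R * z / 2.
Proof.
elim: n => [|n IH] nK; first by rewrite prefix_sum0 !mul0r.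
rewrite prefix_sumS IH; last exact: ltnW.
rewrite /half_late -val_eqE /= modn_small; last lia.
by rewrite (ltn_eqF nK) mul0r addr0 -natr1; field.
Qed.

Let w : R := k.+1%:R * x / m.+1%:R + y.

(** Each row spreads its outflow evenly over the columns, so every column vertex has the same total
    supply [w], positive since x > 0. Releasing half late keeps both paths strictly positive at
    their inner indices. *)
Definition interior_point (e : I) : R :=
  match e with
  | inl (i, _) => half_late x i / m.+1%:R
  | inr j => half_late w j
  end.

Let w_gt0 : 0 < w.
Proof. by rewrite ltr_pwDl// divr_gt0// mulr_gt0. Qed.

Let row_excess_interior : row_excess x interior_point = fun i => x - half_late x i.
Proof.
apply/funext => i; rewrite /row_excess /= sumr_const card_ord.
by rewrite -[_ *+ _]mulr_natr divfK// pnatr_eq0.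
Qed.

Let col_excess_interior : col_excess y interior_point = fun j => w - half_late w j.
Proof.
by apply/funext => j; rewrite /col_excess /= -mulr_suml half_late_sum.
Qed.

Lemma interior_point_sum :
  two_sum (k.+1%:R * x) (k.+1%:R * x + m.+1%:R * y) interior_point.
Proof.
split.
  rewrite sum_inl /= -[RHS]half_late_sum; apply: eq_bigr => i _.
  by rewrite sumr_const card_ord -[_ *+ _]mulr_natr divfK// pnatr_eq0.
by rewrite /= half_late_sum /w mulrDr mulrC divfK// pnatr_eq0.
Qed.

Lemma interior_flow_gt0 (e : E) : 0 < complete_flow x y interior_point e.
Proof.
rewrite /complete_flow /complete_flow_nat.
have : car_edge k.+1 N (val e).1.+1 (val e).2.+1 by have := valP e; rewrite inE.
move: (nat_of_ord (val e).1) (nat_of_ord (val e).2) => i j ce.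
have ipos q : 0 < interior_point q.
  by case: q => [[? ?]|?] /=; rewrite ?divr_gt0// half_late_gt0.
case: ifPn => ik; case: ifPn => jk //.
  rewrite row_excess_interior half_late_prefix; last lia.
  by rewrite divr_gt0// mulr_gt0// ltr0n; move: ce; rewrite /car_edge; lia.
rewrite col_excess_interior half_late_prefix; last by move: ce jk; rewrite /car_edge; lia.
by rewrite divr_gt0// mulr_gt0// ltr0n; move: ce jk; rewrite /car_edge; lia.
Qed.

Lemma flow_polytope_interior : P (complete_flow x y interior_point).
Proof.
split; first by move=> e; apply/ltW/interior_flow_gt0.
exact: (complete_flowP interior_point_sum).
Qed.

Lemma direction_flow_polytope : direction P = is_flow 0 0.
Proof.
apply/seteqP; split => f.
  move=> [d [c [p [q [pP qP fE]]]]].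
  have -> : f = fun e => \sum_l c l * (p l e - q l e) by apply/funext.
  apply: is_flow_comb0 => l i iN.
  rewrite car_netflow00// /netflow !sumrB /=.
  have := (pP l).2 i iN; have := (qP l).2 i iN => <- pqE.
  by move: pqE => /=; lra.
move=> fl; pose f0 := complete_flow x y interior_point.
have f0_gt0 := interior_flow_gt0.
(* The sum dominates each ratio of [|f e|] to [f0 e], so adding [t^-1 * f e] to [f0 e] stays
   nonnegative. The summand 1 keeps [t] positive even for [f = 0]. *)
pose t : R := 1 + \sum_e `|f e| / f0 e.
have t_ge (e : E) : `|f e| <= t * f0 e.
  rewrite -ler_pdivrMr//; apply: (@le_trans _ _ (\sum_e `|f e| / f0 e)).
    rewrite (bigD1 e)//= lerDl sumr_ge0// => e' _.
    by rewrite divr_ge0// ltW.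
  by rewrite lerDr.
have t_gt0 : 0 < t.
  by rewrite ltr_pwDl// sumr_ge0// => e _; rewrite divr_ge0// ltW.
exists 1%N, (fun=> t), (fun=> fun e => f0 e + t^-1 * f e), (fun=> f0); split.
- move=> _; split.
    move=> e; rewrite -(pmulr_rge0 _ t_gt0) mulrDr mulrA divff ?gt_eqF// mul1r.
    by have := t_ge e; have := ler_norm (- f e); rewrite normrN; lra.
  have fl0 : is_flow x y f0 := complete_flowP interior_point_sum.
  have := @is_flow_comb _ _ _ x y 1 (fun=> t^-1) (fun=> f) _ fl0 (fun=> fl).
  by under eq_fun do rewrite big_ord1.
- by move=> _; exact: flow_polytope_interior.
- by move=> e; rewrite big_ord1 addrC addKr mulrA divff ?gt_eqF// mul1r.
Qed.

(** Holding for every lattice basis and every point, this determines the value that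
    [normalized_volume] selects. *)
Lemma car_volume d (B : 'I_d -> E -> R) p : is_lattice_basis P B -> P p ->
  d = ((k.+1 * m.+1).-1 + m)%N /\
  volume_in P B p =
  ((k.+1%:R * x) ^+ (k.+1 * m.+1).-1 / (k.+1 * m.+1).-1`!%:R *
    ((k.+1%:R * x + m.+1%:R * y) ^+ m / m`!%:R) / (k.+1 * m.+1)%:R)%:E.
Proof.
move=> PB Pp.
have zB : is_zbasis (is_flow 0 0) B.
  by have := PB; rewrite /is_lattice_basis /direction_lattice direction_flow_polytope.
have zB' := zbasis_free_edges zB.
have flp : is_flow x y p := Pp.2.
have -> : volume_in P B p =
    volume_in (car_region x y ord0 ord0) (fun i => free_edges (B i)) (free_edges p).
  congr lebesgue_tuple; apply/funext => t /=; apply/propext.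
  have [BW _ _ _] := zB.
  have fl : is_flow x y (fun e => p e + \sum_(i < d) tnth t i * B i e).
    by apply: is_flow_comb => // i; exact: (BW i).1.
  by apply: (iff_trans (flow_polytope_region fl)); rewrite free_edges_comb.
pose j1 : 'I_k.+1 * 'I_m.+1 := (ord0, ord0); pose j2 : 'I_m.+1 := ord0.
have flc := two_corner_sum j1 j2 (k.+1%:R * x) (k.+1%:R * x + m.+1%:R * y).
have Wp := two_sumB (is_flow_two_sum flp) flc; rewrite !subrr in Wp.
have [dE ->] := zbasis_volume (two_basis_zbasis R j1 j2) zB' Wp
  (measurable_car_region x y ord0 ord0).
split; last exact: car_region_volume.
by rewrite dE !cardC1 card_prod !card_ord.
Qed.

Lemma lattice_basis_exists : exists d (B : 'I_d -> E -> R), is_lattice_basis P B.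
Proof.
pose j1 : 'I_k.+1 * 'I_m.+1 := (ord0, ord0).
have zB := zbasis_complete_flow (two_basis_zbasis R j1 (ord0 : 'I_m.+1)).
do 2 eexists; rewrite /is_lattice_basis /direction_lattice direction_flow_polytope.
exact: zB.
Qed.

Lemma car_volume_catalan (a := m.+1) (b := (k.+1 * m.+1 - 1)%N) :
  (((k.+1 * m.+1).-1 + m)`!)%:R *
  ((k.+1%:R * x) ^+ (k.+1 * m.+1).-1 / (k.+1 * m.+1).-1`!%:R *
    ((k.+1%:R * x + m.+1%:R * y) ^+ m / m`!%:R) / (k.+1 * m.+1)%:R) =
  rational_catalan R a b * k.+1%:R ^ (b%:Z - 1) * x ^+ b
     * (k.+1%:R * x + m.+1%:R * y) ^+ (a - 1).
Proof.
rewrite /rational_catalan {}/a {}/b subn1 subn1 /=.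
set b := (k.+1 * m.+1).-1; set c := k.+1%:R * x + _.
have fact_neq0 n : n`!%:R != 0 :> R by rewrite pnatr_eq0 -lt0n fact_gt0.
have K0 : k.+1%:R != 0 :> R by rewrite pnatr_eq0.
have M0 : m.+1%:R != 0 :> R by rewrite pnatr_eq0.
have S0 : (m.+1 + b)%:R != 0 :> R by rewrite pnatr_eq0.
(* The exponent is an integer because [b] can be 0, which happens for a single row and a single
   column. *)
have -> : k.+1%:R ^ (b%:Z - 1) = k.+1%:R ^+ b / k.+1%:R :> R.
  by rewrite expfzDr// exprz_pint.
(* Writing (a+b)! as (a+b) times (a+b-1)! cancels the prefactor of the Catalan number and leaves the
   factorial of the dimension. *)
have binE : 'C(m.+1 + b, m.+1)%:R = ((b + m)`!)%:R * (m.+1 + b)%:R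
    / (m.+1%:R * m`!%:R * b`!%:R) :> R.
  apply: (mulIf (x := m.+1%:R * m`!%:R * b`!%:R)).
    by rewrite !mulf_neq0.
  rewrite divfK ?mulf_neq0// -!natrM; congr (_%:R).
  have := bin_fact (leq_addr b m.+1); rewrite addKn factS => ->.
  by rewrite addSn factS mulnC addnC.
rewrite binE exprMn natrM; clearbody c.
have := fact_neq0 b; have := fact_neq0 m; move: K0 M0 S0.
move: (k.+1%:R : R) (m.+1%:R : R) ((m.+1 + b)%:R : R) (b`!%:R : R) (m`!%:R : R).
by move=> u v s f g u0 v0 s0 g0 f0; field; rewrite f0 g0 s0 u0 v0.
Qed.

End Direction.

Unset Implicit Arguments.

Theorem theorem4p2 (R : realType) (k n : nat) (x y : R)
    (hk : (1 <= k)%N) (hkn : (k < n)%N) (hx : 0 < x) (hy : 0 <= y) :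
  let a := (n - k)%N in
  let b := (k * (n - k) - 1)%N in
  normalized_volume (flow_polytope (car_graph k n) (car_netflow k n x y)) =
  (rational_catalan R a b * k%:R ^ (b%:Z - 1) * x ^+ b
     * (k%:R * x + (n - k)%:R * y) ^+ (a - 1))%:E.
Proof.
case: k hk hkn => // k _ kn.
have [m ->] : exists m, n = (k.+1 + m.+1)%N by exists (n - k.+2)%N; lia.
move=> a b; rewrite {}/b {}/a addKn -car_volume_catalan; set V := (X in X%:E).
(* The default 0 is excluded by exhibiting a basis and a point; uniqueness holds because every
   admissible choice gives the same volume. *)
rewrite /normalized_volume; apply: xget_unique.
  have [d [B PB]] := lattice_basis_exists k m hx hy.
  exists d, B; eexists; split; [exact: PB|exact: flow_polytope_interior|].
  have [dE ->] := car_volume hx hy PB (flow_polytope_interior k m hx hy).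
  by rewrite dE -EFinM.
move=> w [d [B [p [PB Pp ->]]]].
have [dE ->] := car_volume hx hy PB Pp.
by rewrite dE -EFinM.
Qed.
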